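(* Let $(\Omega,\mathcal A,\mu)$ be a $\sigma$-finite measure space, $\tau:\Omega\to\Omega$ a measure preserving transformation, and let $E=E(\Omega)$ be a fully symmetric space on $(\Omega,\mu)$ such that $\mathbf 1\notin E$, where $\mathbf 1=\chi_\Omega$. Then for every $f\in E$ there exists a set $\Omega_f\subset\Omega$ with $\mu(\Omega\setminus\Omega_f)=0$ such that the averages \[ \frac1n\sum_{k=0}^{n-1}\beta_kf(\tau^k\omega) \] converge (as $n\to\infty$) for every $\omega\in\Omega_f$ and every bounded Besicovitch sequence $\{\beta_k\}_{k\ge0}$.
   Context: $\mathcal L^0$ is the space of a.e. equivalence classes of a.e. finite complex-valued measurable functions on $\Omega$; $\mathcal L^0_\mu=\{f\in\mathcal L^0:\mu\{|f|>\lambda\}<\infty\text{ for some }\lambda>0\}$. For $f\in\mathcal L^0_\mu$ its non-increasing rearrangement is $f^*(t)=\inf\{\lambda>0:\mu\{|f|>\lambda\}\le t\}$, $t>0$. Pointwise values of $f$ refer to a fixed representative. Let $\nu$ be Lebesgue measure on $(0,\infty)$, and let $\mathcal L^0_\nu$ be defined as $\mathcal L^0_\mu$ with $((0,\infty),\nu)$ in place of $(\Omega,\mu)$. A non-zero linear subspace $E\subset\mathcal L^0_\nu$ with a Banach norm $\|\cdot\|_E$ is called fully symmetric on $((0,\infty),\nu)$ if $f\in E$, $g\in\mathcal L^0_\nu$ and $\int_0^sg^*(t)\,dt\le\int_0^sf^*(t)\,dt$ for all $s>0$ imply $g\in E$ and $\|g\|_E\le\|f\|_E$. The fully symmetric space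 on $(\Omega,\mu)$ generated by such $E$ is $E(\Omega)=\{f\in\mathcal L^0_\mu:f^*\in E\}$ with norm $\|f\|_{E(\Omega)}=\|f^*\|_E$ (a Banach space); it is again denoted by $E$. With $\mathbb C_1=\{z\in\mathbb C:|z|=1\}$, a trigonometric polynomial is a function $P:\mathbb Z\to\mathbb C$ of the form $P(k)=\sum_{j=1}^s z_j\lambda_j^k$ with $s\in\mathbb N$, $z_j\in\mathbb C$, $\lambda_j\in\mathbb C_1$. A sequence $\{\beta_k\}_{k\ge0}\subset\mathbb C$ is a bounded Besicovitch sequence if (i) $|\beta_k|\le C$ for all $k$ and some $C<\infty$; (ii) for every $\varepsilon>0$ there is a trigonometric polynomial $P$ with $\limsup_n\frac1n\sum_{k=0}^{n-1}|\beta_k-P(k)|<\varepsilon$. *)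

(* Defs.v *)
From HB Require Import structures.
From mathcomp Require Import all_boot all_order all_algebra complex.
From mathcomp Require Import all_classical all_reals all_analysis.

Set Implicit Arguments.
Unset Strict Implicit.
Unset Printing Implicit Defensive.

Import Order.TTheory GRing.Theory Num.Theory.
Import numFieldNormedType.Exports.

Local Open Scope classical_set_scope.
Local Open Scope ring_scope.
Local Open Scope complex_scope.

(* The library norm on R[i] is R[i]-valued; its real part is the modulus. *)
Definition cabs (R : realType) (z : R[i]) : R := complex.Re `|z|.

(* R[i] carries no sigma-algebra in the library. *)
Definition cmeasurable (R : realType) (d : measure_display)
    (T : measurableType d) (f : T -> R[i]) : Prop :=
  measurable_fun setT (fun x => complex.Re (f x)) /\
  measurable_fun setT (fun x => complex.Im (f x)).

Definition superlevel (R : realType) (T : Type) (f : T -> R[i]) (lam : R) :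
    set T :=
  [set x | lam < cabs (f x)].

(* Function spaces are sets of everywhere finite measurable representatives;
   a.e. classes are handled by working up to [f = g %[ae mu]]. *)
Definition L0mu (R : realType) (d : measure_display) (T : measurableType d)
    (mu : {measure set T -> \bar R}) : set (T -> R[i]) :=
  [set f | cmeasurable f /\
    exists2 lam : R, 0 < lam & (mu (superlevel f lam) < +oo)%E].

(* For f in [L0mu mu] and t > 0 the set below is nonempty and bounded below,
   so the real infimum is the mathematical one. *)
Definition rearr (R : realType) (d : measure_display) (T : measurableType d)
    (mu : {measure set T -> \bar R}) (f : T -> R[i]) (t : R) : R :=
  inf [set lam : R | 0 < lam /\ (mu (superlevel f lam) <= t%:E)%E].

(* Lebesgue measure on (0, +oo), realized as the measure on the line that
   gives mass 0 to the complement: functions on (0, +oo) modulo a.e. equality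
   are the functions on R modulo a.e. equality for [halfline R], and values at
   nonpositive points play no role. *)
Definition halfline (R : realType) :
    {measure set (measurableTypeR R) -> \bar R} :=
  mrestr (@lebesgue_measure R) (measurable_itv `]0%R, +oo[).

(* The first clause makes E a union of a.e. classes. *)
Record L0_linear_subspace (R : realType) (d : measure_display)
    (T : measurableType d) (mu : {measure set T -> \bar R})
    (E : set (T -> R[i])) : Prop := {
  subspace_ae : forall f g, E f -> cmeasurable g -> f = g %[ae mu] -> E g ;
  subspace_L0 : E `<=` L0mu mu ;
  subspace_0 : E (fun=> 0) ;
  subspace_lin : forall (a : R[i]) f g,
    E f -> E g -> E (fun x => a * f x + g x) }.

(* A complete norm on the a.e. classes of E. *)
Record banach_norm (R : realType) (d : measure_display)
    (T : measurableType d) (mu : {measure set T -> \bar R})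
    (E : set (T -> R[i])) (N : (T -> R[i]) -> R) : Prop := {
  bnorm_ge0 : forall f, E f -> 0 <= N f ;
  bnorm_eq0 : forall f, E f -> (N f = 0 <-> f = (fun=> 0) %[ae mu]) ;
  bnormZ : forall (a : R[i]) f, E f -> N (fun x => a * f x) = cabs a * N f ;
  bnormD : forall f g, E f -> E g -> N (fun x => f x + g x) <= N f + N g ;
  bnorm_complete : forall u : nat -> T -> R[i], (forall n, E (u n)) ->
    (forall eps : R, 0 < eps -> exists n0 : nat, forall m n : nat,
       (n0 <= m)%N -> (n0 <= n)%N -> N (fun x => u m x - u n x) < eps) ->
    exists2 f, E f & (fun n => N (fun x => u n x - f x)) @ \oo --> (0 : R) }.

Record fully_symmetric (R : realType) (E : set (measurableTypeR R -> R[i]))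
    (N : (measurableTypeR R -> R[i]) -> R) : Prop := {
  fs_subspace : L0_linear_subspace (halfline R) E ;
  fs_neq0 : exists2 f, E f & ~ (f = (fun=> 0) %[ae halfline R]) ;
  fs_norm : banach_norm (halfline R) E N ;
  fs_dominated : forall f g, E f -> L0mu (halfline R) g ->
    (forall s : R, 0 < s ->
      (\int[halfline R]_(t in `]0%R, s[) (rearr (halfline R) g t)%:E <=
       \int[halfline R]_(t in `]0%R, s[) (rearr (halfline R) f t)%:E)%E) ->
    E g /\ N g <= N f }.

(* E(Omega). Its norm is [fun f => N (fun t => (rearr mu f t)%:C)]. *)
Definition generated_space (R : realType) (d : measure_display)
    (T : measurableType d) (mu : {measure set T -> \bar R})
    (E : set (measurableTypeR R -> R[i])) : set (T -> R[i]) :=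
  [set f | L0mu mu f /\ E (fun t => (rearr mu f t)%:C)].

Definition measure_preserving (R : realType) (d : measure_display)
    (T : measurableType d) (mu : {measure set T -> \bar R})
    (tau : T -> T) : Prop :=
  measurable_fun setT tau /\
  forall A, measurable A -> mu (tau @^-1` A) = mu A.

Definition trigonometric_polynomial (R : realType) (P : int -> R[i]) : Prop :=
  exists (s : nat) (z lam : 'I_s -> R[i]),
    (forall j, `|lam j| = 1) /\
    forall k : int, P k = \sum_(j < s) z j * lam j ^ k.

Definition bounded_Besicovitch (R : realType) (beta : nat -> R[i]) : Prop :=
  (exists C : R, forall k, cabs (beta k) <= C) /\
  forall eps : R, 0 < eps ->
    exists2 P : int -> R[i], trigonometric_polynomial P &
      (limn_esup (fun n =>
         (n%:R^-1 * \sum_(k < n) cabs (beta k - P k%:Z))%:E) < eps%:E)%E.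

Definition weighted_average (R : realType) (T : Type) (tau : T -> T)
    (beta : nat -> R[i]) (f : T -> R[i]) (w : T) (n : nat) : R[i] :=
  n%:R^-1 * \sum_(k < n) beta k * f (iter k tau w).

(* Main.v *)
Require Import Defs.
From HB Require Import structures.
From mathcomp Require Import all_boot all_order all_algebra complex.
From mathcomp Require Import all_classical all_reals all_analysis.
From mathcomp Require Import measurable_realfun ring lra.
Import Order.TTheory GRing.Theory Num.Theory.
Import numFieldNormedType.Exports.
Local Open Scope classical_set_scope.
Local Open Scope ring_scope.
Local Open Scope complex_scope.


Set Implicit Arguments.
Unset Strict Implicit.
Unset Printing Implicit Defensive.

(** Why the theorem holds.

    Reduction to bounded integrable functions. If the means of f^* over ]0, s[
    were bounded below by some c > 0, then f^* would dominate the rearrangement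
    of the constant c, and full symmetry would put the constants into E. Hence
    these means get arbitrarily small, and since f and f^* have the same
    distribution function, f restricted to |f| > c is integrable for every
    c > 0 ([integrable_above]). So f is the sum of a uniformly small part, of a
    bounded integrable part, and of a tail beyond a high level whose averages
    are small at almost every point by the maximal ergodic inequality
    ([tail_averages_small]). As the weights are bounded, the small parts are
    harmless. For the bounded part a Besicovitch weight may be replaced by a
    trigonometric polynomial ([besicovitch_mean_cvg]), so it remains to find a
    single null set outside which the averages with weights z^k converge for all
    unimodular z at once: the Wiener-Wintner theorem for a measure preserving
    transformation that need not be ergodic ([wiener_wintner_bounded]).

    Wiener-Wintner. Fix w and put a_k = g(tau^k w). Van der Corput's device
    bounds the averages of z^k a_k by the mean over k of the moduli of the
    exponential averages of a over windows of length H at k. Call z persistent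
    at level eps if these window means stay above eps for every H; persistent
    frequencies are the trace of the atoms of the spectral measure of a. By a
    large sieve there are finitely many of them at each level
    ([persistent_finite]). By
    Birkhoff's theorem the window means converge for almost every w, and then a
    frequency that is not persistent at any level has averages tending to 0.

    There remain the persistent frequencies, which depend on w. Being finite in
    number, each of them is the least persistent angle above some rational s,
    and this choice of an angle theta(w) is measurable (by compactness,
    [persistent_arcP]) and invariant under tau. For one invariant choice,
    convergence follows from Birkhoff's theorem for the skew product
    (w, t) |-> (tau w, t + theta(w)) applied to e(t) g(w)
    ([birkhoff_random_frequency]); countably many choices cover all persistent
    frequencies. *)


(** * The modulus on the complex numbers and the unit circle *)

Section modulus.
Context (R : realType).
Implicit Types (z w : R[i]) (x : R).

Lemma cabsC z : (cabs z)%:C = `|z|.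
Proof. by rewrite /cabs RRe_real // normr_real. Qed.

Lemma cabs_sqrt z : cabs z = Num.sqrt (complex.Re z ^+ 2 + complex.Im z ^+ 2).
Proof. by rewrite /cabs normc_def. Qed.

Lemma cabs_ge0 z : 0 <= cabs z.
Proof. by rewrite -ler0c cabsC. Qed.

Lemma cabs0 : cabs (0 : R[i]) = 0.
Proof. by apply: complexI; rewrite cabsC normr0. Qed.

Lemma cabsM z w : cabs (z * w) = cabs z * cabs w.
Proof. by apply: complexI; rewrite rmorphM /= !cabsC normrM. Qed.

Lemma cabsX z n : cabs (z ^+ n) = cabs z ^+ n.
Proof. by apply: complexI; rewrite rmorphXn /= !cabsC normrX. Qed.

Lemma cabsN z : cabs (- z) = cabs z.
Proof. by apply: complexI; rewrite !cabsC normrN. Qed.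

Lemma cabs_distC z w : cabs (z - w) = cabs (w - z).
Proof. by rewrite -cabsN opprB. Qed.

Lemma cabsR x : cabs x%:C = `|x|.
Proof. by apply: complexI; rewrite cabsC normc_def /= expr0n addr0 sqrtr_sqr. Qed.

Lemma cabs_natV n : cabs (n%:R^-1 : R[i]) = n%:R^-1.
Proof.
by rewrite -(rmorph_nat (real_complex R)) -fmorphV cabsR ger0_norm ?invr_ge0.
Qed.

Lemma cabsD z w : cabs (z + w) <= cabs z + cabs w.
Proof. by rewrite -lecR rmorphD /= !cabsC ler_normD. Qed.

Lemma cabs_dist_add z w v : cabs (z - w) <= cabs (z - v) + cabs (v - w).
Proof. by rewrite -[z - w](subrKA v) cabsD. Qed.

Lemma cabs_distB z w : `|cabs z - cabs w| <= cabs (z - w).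
Proof.
have h1 := cabsD (z - w) w; have h2 := cabsD (w - z) z.
by move: h1 h2; rewrite !subrK (cabs_distC w z) ler_norml; lra.
Qed.

Lemma cabs_sum (I : Type) (r : seq I) (P : pred I) (F : I -> R[i]) :
  cabs (\sum_(i <- r | P i) F i) <= \sum_(i <- r | P i) cabs (F i).
Proof.
elim/big_ind2: _ => [|z a w b za wb|//]; first by rewrite cabs0.
exact: le_trans (cabsD _ _) (lerD za wb).
Qed.

Lemma Re_le_cabs z : `|complex.Re z| <= cabs z.
Proof. by rewrite -lecR cabsC normc_ge_Re. Qed.

Lemma Im_le_cabs z : `|complex.Im z| <= cabs z.
Proof.
by rewrite cabs_sqrt -sqrtr_sqr ler_wsqrtr // lerDr sqr_ge0.
Qed.

Lemma cabs_le_ReIm z : cabs z <= `|complex.Re z| + `|complex.Im z|.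
Proof.
rewrite cabs_sqrt -[leRHS]ger0_norm ?addr_ge0 // -sqrtr_sqr ler_wsqrtr //.
by rewrite sqrrD !real_normK ?num_real // lerD2r lerDl mulrn_wge0 ?mulr_ge0.
Qed.

Lemma Re_sum n (F : 'I_n -> R[i]) :
  complex.Re (\sum_k F k) = \sum_k complex.Re (F k).
Proof. by apply: big_morph => // x y; case: x => ? ?; case: y. Qed.

Lemma Im_sum n (F : 'I_n -> R[i]) :
  complex.Im (\sum_k F k) = \sum_k complex.Im (F k).
Proof. by apply: big_morph => // x y; case: x => ? ?; case: y. Qed.

Lemma natV_complex n : n%:R^-1 = (n%:R^-1)%:C :> R[i].
Proof. by rewrite fmorphV rmorph_nat. Qed.

Lemma Re_scale x z : complex.Re (x%:C * z) = x * complex.Re z.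
Proof. by case: z => a b /=; rewrite mul0r subr0. Qed.

Lemma Im_scale x z : complex.Im (x%:C * z) = x * complex.Im z.
Proof. by case: z => a b /=; rewrite mul0r addr0. Qed.

Lemma cvgn_complex (u : nat -> R[i]) :
  cvgn (fun n => complex.Re (u n)) -> cvgn (fun n => complex.Im (u n)) ->
  cvgn (u : nat -> R[i]^o).
Proof.
move=> /cvg_ex[a ua] /cvg_ex[b ub]; apply/cvg_ex; exists (a +i* b).
apply/cvgrPdist_lt => e e0.
have [r er] : exists r : R, e = r%:C.
  by exists (complex.Re e); rewrite RRe_real ?gtr0_real.
rewrite er in e0 *; rewrite ltcR in e0.
have r2 : 0 < r / 2 by rewrite divr_gt0.
move/cvgrPdist_lt : ua => /(_ _ r2) ua; move/cvgrPdist_lt : ub => /(_ _ r2) ub.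
near=> n; rewrite -cabsC ltcR.
apply: le_lt_trans (cabs_le_ReIm _) _; rewrite [ltRHS]splitr.
have -> : complex.Re (a +i* b - u n) = a - complex.Re (u n) by case: (u n).
have -> : complex.Im (a +i* b - u n) = b - complex.Im (u n) by case: (u n).
by apply: ltrD; near: n.
Unshelve. all: by end_near.
Qed.

Lemma cauchy_cvgn_real (u : nat -> R) :
  (forall e : R, 0 < e -> exists N, forall m n, (N <= m)%N -> (N <= n)%N ->
     `|u m - u n| <= e) -> cvgn u.
Proof.
move=> cu; apply: cauchy_cvg; apply: cauchy_exP => e e0.
have [N uN] := cu (e / 2) (divr_gt0 e0 (ltr0n _ 2)).
exists (u N); exists N => // n /= Nn.
by rewrite /ball /=; apply: le_lt_trans (uN N n (leqnn N) Nn) _; lra.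
Qed.

Lemma cauchy_cvgn_complex (u : nat -> R[i]) :
  (forall e : R, 0 < e -> exists N, forall m n, (N <= m)%N -> (N <= n)%N ->
     cabs (u m - u n) <= e) ->
  cvgn (u : nat -> R[i]^o).
Proof.
move=> cu; apply: cvgn_complex; apply: cauchy_cvgn_real => e /cu[N uN];
  exists N => m n Nm Nn; apply: le_trans (uN m n Nm Nn).
- by rewrite -(raddfB (@complex.Re R : Rcomplex R -> R)) Re_le_cabs.
- by rewrite -(raddfB (@complex.Im R : Rcomplex R -> R)) Im_le_cabs.
Qed.

Lemma cvgn_complex_cauchy (u : nat -> R[i]) :
  cvgn (u : nat -> R[i]^o) ->
  (forall e : R, 0 < e -> exists N, forall m n, (N <= m)%N -> (N <= n)%N ->
     cabs (u m - u n) <= e).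
Proof.
move=> /cvg_ex[l /cvgrPdist_le ul] e e0.
have e20 : 0 < ((e / 2)%:C : R[i]) by rewrite ltcR divr_gt0.
have [N _ uN] := ul _ e20; exists N => m n Nm Nn.
apply: le_trans (cabs_dist_add _ _ l) _; rewrite [leRHS]splitr.
apply: lerD; rewrite -lecR cabsC; last exact: uN.
by rewrite distrC; exact: uN.
Qed.

End modulus.

Section circle.
Context (R : realType).
Implicit Types (s t : R).

Definition circle t : R[i] := cos (pi *+ 2 * t) +i* sin (pi *+ 2 * t).

Lemma cabs_circle t : cabs (circle t) = 1.
Proof. by rewrite cabs_sqrt /= cos2Dsin2 sqrtr1. Qed.

Lemma circleD s t : circle (s + t) = circle s * circle t.
Proof. by rewrite /circle mulrDr cosD sinD; simpc; rewrite [in X in _ +i* X]addrC. Qed.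

Lemma circle0 : circle 0 = 1.
Proof. by rewrite /circle mulr0 cos0 sin0. Qed.

Lemma circle1 : circle 1 = 1.
Proof. by rewrite /circle mulr1 cos2pi sin2pi. Qed.

Lemma circleN1 : circle (-1) = 1.
Proof. by have := circleD (-1) 1; rewrite addNr circle0 circle1 mulr1. Qed.

Lemma circle_inj s t : 0 <= s < 1 -> 0 <= t < 1 -> circle s = circle t -> s = t.
Proof.
wlog st : s t / s <= t.
  move=> h s01 t01 e; have [st|/ltW ts] := leP s t; first exact: h.
  by apply/esym; apply: h.
move=> /andP[s0 s1] /andP[t0 t1] e; apply/eqP; rewrite eq_le st /= leNgt.
apply/negP => lt_st.
have : circle (t - s) = 1.
  by rewrite circleD -e -circleD subrr circle0.
have s2 := sin2cos2 (pi * (t - s)).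
case=> + _; rewrite mulrnAl cos_mulr2n => c1.
have : sin (pi * (t - s)) ^+ 2 = 0 by rewrite s2; move: c1; rewrite mulr2n; lra.
move/eqP; rewrite sqrf_eq0 => /eqP s0'.
have : 0 < sin (pi * (t - s)).
  apply: sin_gt0_pi; rewrite mulr_gt0 ?pi_gt0 ?subr_gt0 //=.
  by rewrite -[ltRHS]mulr1 ltr_pM2l ?pi_gt0 //; lra.
by rewrite s0' ltxx.
Qed.

Lemma circle_surj (z : R[i]) : `|z| = 1 -> exists2 t, 0 <= t < 1 & circle t = z.
Proof.
case: z => x y; rewrite -cabsC => -[]; rewrite cabs_sqrt /= => xy.
have {}xy : x ^+ 2 + y ^+ 2 = 1.
  by rewrite -[LHS]sqr_sqrtr ?xy ?expr1n // addr_ge0 ?sqr_ge0.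
have x1 : -1 <= x <= 1.
  have := sqr_ge0 y; have := sqr_ge0 (x - 1); have := sqr_ge0 (x + 1).
  rewrite -ler_norml -(@ler_sqr _ `|x| 1) ?nnegrE // real_normK ?num_real //.
  by rewrite expr1n; lra.
have pp : 0 < pi *+ 2 :> R by rewrite mulrn_wgt0 ?pi_gt0.
have [y0|y0] := leP 0 y.
  exists (acos x / (pi *+ 2)).
    rewrite divr_ge0 ?acos_ge0 ?(ltW pp) //= ltr_pdivrMr // mul1r.
    by apply: le_lt_trans (acos_lepi x1) _; rewrite mulr2n ltrDl pi_gt0.
  rewrite /circle mulrC divfK ?gt_eqF // acosK ?in_itv //= sin_acos //.
  by congr (_ +i* _); rewrite -xy addrAC subrr add0r sqrtr_sqr ger0_norm.
have ac1 : acos x < pi.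
  apply: acos_ltpi; move: x1 => /andP[x1 ->]; rewrite andbT lt_neqAle x1 andbT.
  by apply: contraTneq y0 => xN; move: xy; rewrite -xN sqrrN expr1n => /eqP;
     rewrite -subr_eq0 addrAC subrr add0r sqrf_eq0 => /eqP ->; rewrite ltxx.
have ac0 : 0 < acos x.
  apply: acos_gt0; move: x1 => /andP[-> x1]; rewrite /= lt_neqAle x1 andbT.
  by apply: contraTneq y0 => xN; move: xy; rewrite xN expr1n => /eqP;
     rewrite -subr_eq0 addrAC subrr add0r sqrf_eq0 => /eqP ->; rewrite ltxx.
exists (1 - acos x / (pi *+ 2)).
  rewrite subr_ge0 ltrBlDr ltrDl divr_gt0 // andbT ler_pdivrMr // mul1r.
  by apply: le_trans (ltW ac1) _; rewrite mulr2n lerDl ltW ?pi_gt0.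
rewrite circleD circle1 mul1r /circle mulrN mulrC divfK ?gt_eqF //.
rewrite cosN sinN acosK ?in_itv //= sin_acos //.
congr (_ +i* _); rewrite -xy addrAC subrr add0r sqrtr_sqr ltr0_norm //.
by rewrite opprK.
Qed.

Lemma circle_continuous t (e : R) : 0 < e ->
  exists2 r : R, 0 < r & forall s, `|s - t| < r -> cabs (circle s - circle t) <= e.
Proof.
move=> e0; have e2 : 0 < e / 2 by rewrite divr_gt0.
have cont (f : R -> R) : continuous f ->
    \forall s \near t, `|f (pi *+ 2 * s) - f (pi *+ 2 * t)| <= e / 2.
  move=> cf.
  have : (fun s => f (pi *+ 2 * s)) @ t --> f (pi *+ 2 * t).
    apply: continuous_comp; last exact: cf.
    exact: mulrl_continuous.
  by move=> /cvgrPdist_le /(_ _ e2); apply: filterS => s; rewrite distrC.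
have [r /= r0 rs] : nbhs_ball t _ := (nbhs_ballP _ _).1
  (filterI (cont _ (@continuous_cos R)) (cont _ (@continuous_sin R))).
exists r => // s st.
have [] := rs s; first by rewrite /ball /= distrC.
move=> h1 h2; apply: le_trans (cabs_le_ReIm _) _; rewrite /= [leRHS]splitr.
exact: lerD.
Qed.

End circle.

(** * Persistent frequencies of a bounded sequence *)

Section almost_orthogonality.
Context (R : realType).

Lemma cabs_sqr (z : R[i]) : (cabs z ^+ 2)%:C = z * z^*%C.
Proof. by rewrite rmorphXn /= cabsC sqr_normc. Qed.

Lemma cabs_conj (z : R[i]) : cabs z^*%C = cabs z.
Proof. by apply: complexI; rewrite !cabsC normcJ. Qed.

(** Bessel's inequality for an almost orthonormal family e: expand
    |v - t \sum_j <v, e_j> e_j|^2 >= 0, bound the quadratic term by Schur's test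
    on the Gram matrix, and take t = 1/B. *)
Lemma bessel_gram (I J : finType) (v : I -> R[i]) (e : J -> I -> R[i]) (B : R) :
  0 < B ->
  (forall j, \sum_l cabs (\sum_h (e j h)^*%C * e l h) <= B) ->
  \sum_j cabs (\sum_h v h * e j h) ^+ 2 <= B * \sum_h cabs (v h) ^+ 2.
Proof.
move=> B0 eB.
pose c j := \sum_h v h * e j h.
pose G j l := \sum_h (e j h)^*%C * e l h.
pose g h := \sum_j c j * (e j h)^*%C.
pose S := \sum_j cabs (c j) ^+ 2.
pose V := \sum_h cabs (v h) ^+ 2.
pose W := \sum_h cabs (g h) ^+ 2.
have vg : \sum_h v h * (g h)^*%C = S%:C.
  rewrite /S rmorph_sum /=.
  under eq_bigr do rewrite /g rmorph_sum mulr_sumr /=.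
  rewrite exchange_big /=; apply: eq_bigr => j _; rewrite cabs_sqr.
  rewrite [X in _ = X * _]/c mulr_suml; apply: eq_bigr => h _.
  by rewrite rmorphM /= conjcK; ring.
have gv : \sum_h g h * (v h)^*%C = S%:C.
  rewrite -conjc_real -vg rmorph_sum; apply: eq_bigr => h _.
  by rewrite rmorphM /= conjcK mulrC.
have expand (t : R) :
    \sum_h cabs (v h - t%:C * g h) ^+ 2 = V - 2%:R * t * S + t ^+ 2 * W.
  apply: complexI.
  have -> : (V - 2%:R * t * S + t ^+ 2 * W)%:C =
      V%:C - (t%:C * S%:C + t%:C * S%:C) + t%:C ^+ 2 * W%:C.
    by rewrite -!rmorphM -rmorphXn -!rmorphD -rmorphM -rmorphB -rmorphD /=;
       congr (_%:C); ring.
  rewrite -{1}vg -gv /V /W !rmorph_sum /= !mulr_sumr -big_split /= -sumrB.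
  rewrite -big_split /=; apply: eq_bigr => h _.
  rewrite !cabs_sqr.
  have -> : (v h - t%:C * g h)^*%C = (v h)^*%C - t%:C * (g h)^*%C.
    by rewrite -[in RHS](conjc_real t) -rmorphM -rmorphB.
  ring.
have Gsym j l : cabs (G j l) = cabs (G l j).
  rewrite -[RHS]cabs_conj /G rmorph_sum; congr cabs; apply: eq_bigr => h _.
  by rewrite rmorphM /= conjcK mulrC.
have W_le : W <= B * S.
  have WE : W%:C = \sum_j \sum_l c j * (c l)^*%C * G j l.
    rewrite /W rmorph_sum /=.
    transitivity (\sum_h \sum_j \sum_l
        c j * (c l)^*%C * ((e j h)^*%C * e l h)); last first.
      rewrite exchange_big /=; apply: eq_bigr => j _.
      rewrite exchange_big /=; apply: eq_bigr => l _.
      by rewrite /G mulr_sumr.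
    apply: eq_bigr => h _; rewrite cabs_sqr {1}/g mulr_suml.
    apply: eq_bigr => j _; rewrite /g rmorph_sum mulr_sumr /=.
    apply: eq_bigr => l _; rewrite rmorphM /= conjcK; ring.
  have W0 : 0 <= W by apply: sumr_ge0 => h _; exact: sqr_ge0.
  rewrite -[leLHS]ger0_norm // -cabsR WE.
  pose F j l := cabs (c j) ^+ 2 * cabs (G j l).
  have sF : \sum_j \sum_l F j l <= B * S.
    rewrite mulr_sumr; apply: ler_sum => j _.
    by rewrite /F -mulr_sumr mulrC; apply: ler_wpM2r (eB j); exact: sqr_ge0.
  apply: (@le_trans _ _ (\sum_j \sum_l (F j l + F l j) / 2)).
    apply: le_trans (cabs_sum _ _ _) _; apply: ler_sum => j _.
    apply: le_trans (cabs_sum _ _ _) _; apply: ler_sum => l _.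
    rewrite !cabsM cabs_conj /F (Gsym l j) -mulrDl [leRHS]mulrAC.
    apply: ler_wpM2r; first exact: cabs_ge0.
    have := sqr_ge0 (cabs (c j) - cabs (c l)); rewrite sqrrB; lra.
  apply: le_trans sF.
  under eq_bigr do rewrite -mulr_suml big_split /=.
  rewrite -mulr_suml big_split /= [X in _ + X]exchange_big /=; lra.
have : 0 <= V - 2%:R * B^-1 * S + B^-1 ^+ 2 * W.
  by rewrite -expand sumr_ge0 // => h _; exact: sqr_ge0.
have -> : \sum_j cabs (\sum_h v h * e j h) ^+ 2 = S by [].
have : B^-1 ^+ 2 * W <= B^-1 * S.
  by rewrite expr2 -mulrA ler_pM2l ?invr_gt0 // ler_pdivrMl.
move=> h1 h2; rewrite -ler_pdivrMl // -/V; lra.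
Qed.

Lemma geometric_sum_bound (w : R[i]) H : cabs w = 1 -> w != 1 ->
  cabs (\sum_(h < H) w ^+ h) <= 2 / cabs (1 - w).
Proof.
move=> w1 wn1.
have d0 : 0 < cabs (1 - w).
  by rewrite lt_neqAle cabs_ge0 andbT eq_sym; apply/eqP => e0; move: wn1;
     rewrite eq_sym -subr_eq0 -normr_eq0 -cabsC e0 eqxx.
rewrite ler_pdivlMr // mulrC -cabsM -(opprB w) mulNr cabsN -subrX1.
apply: le_trans (cabsD _ _) _; rewrite cabsX w1 expr1n cabsN.
by rewrite -(rmorph1 (real_complex R)) cabsR normr1.
Qed.

(** A large sieve for finitely many distinct frequencies: off the diagonal the
    Gram matrix of the vectors (z_j^h)_{h < H} stays bounded as H grows. *)
Lemma large_sieve r (z : 'I_r -> R[i]) :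
  (forall j, cabs (z j) = 1) -> injective z ->
  exists2 K : R, 0 <= K & forall H (v : nat -> R[i]), (0 < H)%N ->
    \sum_j cabs (\sum_(h < H) v h * z j ^+ h) ^+ 2 <=
    (H%:R + K) * \sum_(h < H) cabs (v h) ^+ 2.
Proof.
move=> z1 zinj.
pose k j l := 2 / cabs (1 - (z j)^*%C * z l).
have k0 j l : 0 <= k j l by rewrite divr_ge0 ?cabs_ge0.
exists (\sum_j \sum_l k j l).
  by apply: sumr_ge0 => j _; apply: sumr_ge0.
move=> H v H0.
apply: (bessel_gram (fun h : 'I_H => v h) (e := fun j (h : 'I_H) => z j ^+ h)).
  by rewrite ltr_pwDl ?ltr0n //; apply: sumr_ge0 => j _; apply: sumr_ge0.
move=> j.
have zz : (z j)^*%C * z j = 1.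
  by rewrite mulrC -sqr_normc -cabsC z1 expr1n.
apply: (@le_trans _ _ (\sum_l (H%:R * (l == j)%:R + k j l))).
  apply: ler_sum => l _.
  under eq_bigr do rewrite rmorphXn -exprMn.
  have [->|lj] := eqVneq l j.
    rewrite zz /= mulr1 (eq_bigr (fun=> 1)); last by move=> h _; rewrite expr1n.
    rewrite sumr_const card_ord -(rmorph_nat (real_complex R)) cabsR normr_nat.
    by rewrite lerDl.
  rewrite mulr0 add0r; apply: geometric_sum_bound.
    by rewrite cabsM cabs_conj !z1 mulr1.
  apply: contraNneq lj => e; apply/eqP/zinj.
  by rewrite -[z l]mul1r -zz mulrAC e mul1r.
rewrite big_split /= -mulr_sumr (bigD1 j) //= eqxx big1 ?addr0 ?mulr1; last first.
  by move=> l /negbTE ->.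
rewrite lerD2l [leRHS](bigD1 j) //= lerDl.
by apply: sumr_ge0 => i _; apply: sumr_ge0.
Qed.

End almost_orthogonality.

Section windows.
Context (R : realType).
Implicit Types (a : nat -> R[i]) (z w : R[i]) (M : R).

Definition exponential_average a z n : R[i] :=
  n%:R^-1 * \sum_(k < n) z ^+ k * a k.

Definition window a H z k : R :=
  cabs (H%:R^-1 * \sum_(h < H) a (k + h)%N * z ^+ h).

Definition window_mean a H z n : R := n%:R^-1 * \sum_(k < n) window a H z k.

(** Every window length keeps, in the long run, a mean correlation at least eps
    between a and these frequencies. They play the role of the atoms of the spectral measure
    of the sequence a. *)
Definition persistent a (eps : R) : set R[i] :=
  [set z | forall H, (0 < H)%N -> forall x, x < eps ->
     \forall n \near \oo, x <= window_mean a H z n].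

Lemma mean_le n (x y : nat -> R) : (forall k, (k < n)%N -> x k <= y k) ->
  n%:R^-1 * \sum_(k < n) x k <= n%:R^-1 * \sum_(k < n) y k.
Proof.
move=> xy; apply: ler_wpM2l; first by rewrite invr_ge0.
by apply: ler_sum => k _; exact: xy.
Qed.

Lemma mean_cst n (x : R) : (0 < n)%N -> n%:R^-1 * \sum_(k < n) x = x.
Proof.
by move=> n0; rewrite sumr_const card_ord -[x *+ n]mulr_natl mulKf // pnatr_eq0 -lt0n.
Qed.

Lemma mean_le_cst n (x : nat -> R) (y : R) : 0 <= y ->
  (forall k, (k < n)%N -> x k <= y) -> n%:R^-1 * \sum_(k < n) x k <= y.
Proof.
move=> y0 xy; case: n xy => [|n] xy; first by rewrite invr0 mul0r.
by rewrite -[leRHS](@mean_cst n.+1) //; exact: (mean_le (y := fun=> y)).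
Qed.

Lemma window_ge0 a H z k : 0 <= window a H z k.
Proof. exact: cabs_ge0. Qed.

Lemma window_le a M H z k : 0 <= M -> (forall k, cabs (a k) <= M) ->
  cabs z = 1 -> window a H z k <= M.
Proof.
move=> M0 aM z1; rewrite /window cabsM cabs_natV.
apply: le_trans (_ : _ <= H%:R^-1 * \sum_(h < H) cabs (a (k + h)%N)) _.
  apply: ler_wpM2l; first by rewrite invr_ge0.
  apply: le_trans (cabs_sum _ _ _) _; apply: ler_sum => h _.
  by rewrite cabsM cabsX z1 expr1n mulr1.
exact: (mean_le_cst (x := fun h => cabs (a (k + h)%N))).
Qed.

(** On windows that are long compared with the gaps between the frequencies the
    exponentials are almost orthogonal, so that the large sieve bounds the
    number of frequencies that keep a mean correlation eps with a. *)
Lemma persistent_finite a M (eps : R) : 0 < eps -> 0 <= M ->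
  (forall k, cabs (a k) <= M) ->
  exists r0, forall r (z : 'I_r -> R[i]), (forall j, cabs (z j) = 1) ->
    injective z -> (forall j, persistent a eps (z j)) -> (r <= r0)%N.
Proof.
move=> e0 M0 aM; pose x := eps / 2.
have x0 : 0 < x by rewrite divr_gt0.
have x_eps : x < eps by rewrite /x; lra.
exists (Num.truncn (2 * M ^+ 2 / x ^+ 2)) => r z z1 zinj zp.
have [K K0 sieve] := large_sieve z1 zinj.
pose H := (Num.truncn K).+1.
have KH : K <= H%:R by exact/ltW/truncnS_gt.
have H0 : 0 < H%:R :> R by rewrite ltr0n.
(* As K <= H, the sieve constant H + K is at most 2 H. *)
have sumw k : \sum_j window a H (z j) k ^+ 2 <= 2 * M ^+ 2.
  have := sieve H (fun h => a (k + h)%N) isT.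
  under [in X in _ -> X]eq_bigr do rewrite /window cabsM cabs_natV exprMn.
  rewrite -mulr_sumr => h.
  apply: le_trans (ler_wpM2l _ h) _; first by rewrite exprn_ge0 ?invr_ge0 ?ltW.
  have sM : \sum_(h < H) cabs (a (k + h)%N) ^+ 2 <= H%:R * M ^+ 2.
    rewrite mulr_natl -[H in leRHS]card_ord -sumr_const.
    by apply: ler_sum => i _; rewrite ler_sqr ?nnegrE ?cabs_ge0.
  apply: (@le_trans _ _ (H%:R^-1 ^+ 2 * ((H%:R + H%:R) * (H%:R * M ^+ 2)))).
    apply: ler_wpM2l; first by rewrite exprn_ge0 ?invr_ge0 ?ltW.
    apply: ler_pM sM; [exact: addr_ge0| |by rewrite lerD2l].
    by apply: sumr_ge0 => i _; exact: sqr_ge0.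
  by rewrite le_eqVlt; apply/orP; left; apply/eqP; field; rewrite gt_eqF.
have [N _ hN] : \forall n \near \oo, forall j, x <= window_mean a H (z j) n.
  by apply: filter_forall => j; exact: zp.
pose n := N.+1.
have xw j : x <= window_mean a H (z j) n by apply: hN => /=; rewrite /n.
(* 2 x y - x^2 <= y^2 turns the lower bound on the mean of the moduli into one
   on the mean of their squares. *)
have xw2 j : x ^+ 2 <= n%:R^-1 * \sum_(k < n) window a H (z j) k ^+ 2.
  apply: (@le_trans _ _ (n%:R^-1 * \sum_(k < n)
      (2 * x * window a H (z j) k - x ^+ 2))); last first.
    apply: (mean_le (x := fun k => 2 * x * window a H (z j) k - x ^+ 2)
                    (y := fun k => window a H (z j) k ^+ 2)) => k _.
    have := sqr_ge0 (window a H (z j) k - x); rewrite sqrrB; lra.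
  rewrite sumrB mulrBr mean_cst // -mulr_sumr mulrCA -/(window_mean _ _ _ _).
  have : x * x <= x * window_mean a H (z j) n by rewrite ler_pM2l.
  by rewrite expr2; lra.
have : r%:R * x ^+ 2 <= 2 * M ^+ 2.
  rewrite mulr_natl -[r in leLHS]card_ord -sumr_const.
  apply: le_trans (ler_sum _ (fun j _ => xw2 j)) _.
  rewrite -mulr_sumr exchange_big /=.
  apply: (mean_le_cst (x := fun k => \sum_j window a H (z j) k ^+ 2)) => //.
  by rewrite mulr_ge0 ?exprn_ge0.
rewrite -ler_pdivlMr ?exprn_gt0 // => h.
rewrite truncn_ge_nat //.
by rewrite divr_ge0 ?mulr_ge0 ?exprn_ge0 // ltW.
Qed.

Lemma sum_shift_le (s : nat -> R[i]) M h n : (forall k, cabs (s k) <= M) ->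
  cabs (\sum_(k < n) s (k + h)%N - \sum_(k < n) s k) <= 2 * h%:R * M.
Proof.
move=> sM; elim: h => [|h IH].
  under [X in X - _]eq_bigr do rewrite addn0.
  by rewrite subrr cabs0 mulr0 mul0r.
have -> : \sum_(k < n) s (k + h.+1)%N =
    \sum_(k < n) s (k + h)%N + (s (n + h)%N - s h).
  elim: n {IH} => [|n IH]; first by rewrite !big_ord0 subrr addr0.
  rewrite !big_ord_recr /= IH addnS addSn.
  ring.
rewrite addrAC; apply: le_trans (cabsD _ _) _.
have := cabsD (s (n + h)%N) (- s h); rewrite cabsN.
have := sM (n + h)%N; have := sM h; move: IH.
rewrite -[h.+1%:R]natr1 mulrDr mulrDl mulr1; lra.
Qed.

(** Van der Corput: averaging a over windows of length H before taking the
    exponential average changes the latter by O(H / n). *)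
Lemma van_der_corput a M H z n : (forall k, cabs (a k) <= M) -> (0 < H)%N ->
  cabs z = 1 ->
  cabs (exponential_average a z n) <= window_mean a H z n + 2 * H%:R * M / n%:R.
Proof.
move=> aM H0 z1.
have HC : H%:R != 0 :> R[i] by rewrite pnatr_eq0 -lt0n.
pose s k := z ^+ k * a k.
have sM k : cabs (s k) <= M by rewrite cabsM cabsX z1 expr1n mul1r.
pose W := H%:R^-1 * \sum_(h < H) \sum_(k < n) s (k + h)%N.
have cW : cabs W <= \sum_(k < n) window a H z k.
  have -> : W = \sum_(k < n) z ^+ k * (H%:R^-1 * \sum_(h < H) a (k + h)%N * z ^+ h).
    rewrite /W exchange_big /= mulr_sumr; apply: eq_bigr => k _.
    rewrite mulrCA; congr (_ * _); rewrite mulr_sumr; apply: eq_bigr => h _.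
    by rewrite /s exprD mulrAC mulrA.
  apply: le_trans (cabs_sum _ _ _) _; apply: ler_sum => k _.
  by rewrite cabsM cabsX z1 expr1n mul1r.
have dW : cabs (\sum_(k < n) s k - W) <= 2 * H%:R * M.
  have -> : \sum_(k < n) s k - W =
      H%:R^-1 * \sum_(h < H) (\sum_(k < n) s k - \sum_(k < n) s (k + h)%N).
    by rewrite sumrB mulrBr sumr_const card_ord -[X in _ * X]mulr_natl mulKf.
  rewrite cabsM cabs_natV ler_pdivrMl ?ltr0n //.
  apply: le_trans (cabs_sum _ _ _) _.
  apply: (@le_trans _ _ (\sum_(h < H) 2 * H%:R * M)); last first.
    by rewrite sumr_const card_ord -[leLHS]mulr_natl.
  apply: ler_sum => h _; rewrite cabs_distC; apply: le_trans (sum_shift_le _ _ sM) _.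
  have M0 : 0 <= M by exact: le_trans (cabs_ge0 _) (aM 0%N).
  apply: ler_wpM2r => //; apply: ler_wpM2l => //.
  by rewrite ler_nat ltnW.
rewrite /exponential_average cabsM cabs_natV /window_mean [_ / n%:R]mulrC -mulrDr.
apply: ler_wpM2l; first by rewrite invr_ge0.
rewrite -[X in cabs X](subrK W); apply: le_trans (cabsD _ _) _.
by rewrite addrC; exact: lerD.
Qed.

Lemma near_div_nat_le (c e : R) : 0 < e -> \forall n \near \oo, c / n%:R <= e.
Proof.
move=> e0; exists (Num.truncn (`|c| / e)).+1 => // n /= hn.
have n0 : 0 < n%:R :> R by rewrite ltr0n (leq_trans _ hn).
rewrite ler_pdivrMr // mulrC -ler_pdivrMr //.
apply: le_trans (_ : `|c| / e <= _).
  by rewrite ler_pM2r ?invr_gt0 // ler_norm.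
by apply/ltW/(lt_le_trans (truncnS_gt _)); rewrite ler_nat.
Qed.

Lemma not_persistent_small a M (eps : R) z : 0 < eps ->
  (forall k, cabs (a k) <= M) -> cabs z = 1 ->
  (forall H, cvgn (window_mean a H z)) -> ~ persistent a eps z ->
  \forall n \near \oo, cabs (exponential_average a z n) <= 2 * eps.
Proof.
move=> e0 aM z1 cw /existsNP[H /not_implyP[H0 /existsNP[x /not_implyP[xe nx]]]].
have wl : \forall n \near \oo, window_mean a H z n <= eps.
  have /cvg_ex[l wl] := cw H.
  have le_l : l <= x.
    rewrite leNgt; apply/negP => xl; apply: nx.
    by apply: (cvgr_ge l wl).
  near=> n; apply: ltW; near: n.
  exact: (cvgr_lt l wl _ (le_lt_trans le_l xe)).
apply: filterS2 wl (near_div_nat_le (2 * H%:R * M) e0) => n h1 h2.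
by apply: le_trans (van_der_corput n aM H0 z1) _; lra.
Unshelve. all: by end_near.
Qed.

Lemma unimodular_expB z w h : cabs z = 1 -> cabs w = 1 ->
  cabs (z ^+ h - w ^+ h) <= h%:R * cabs (z - w).
Proof.
move=> z1 w1; elim: h => [|h IH]; first by rewrite subrr cabs0 mul0r.
have -> : z ^+ h.+1 - w ^+ h.+1 = z * (z ^+ h - w ^+ h) + (z - w) * w ^+ h.
  by rewrite !exprS; ring.
apply: le_trans (cabsD _ _) _.
by rewrite !cabsM cabsX w1 z1 expr1n mulr1 mul1r -natr1 mulrDl mul1r lerD2r.
Qed.

Lemma window_mean_lipschitz a M H z w n : 0 <= M ->
  (forall k, cabs (a k) <= M) -> cabs z = 1 -> cabs w = 1 ->
  window_mean a H w n <= window_mean a H z n + M * H%:R * cabs (z - w).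
Proof.
move=> M0 aM z1 w1.
rewrite -lerBlDl /window_mean -mulrBr -sumrB.
apply: (mean_le_cst (x := fun k => window a H w k - window a H z k)).
  by rewrite !mulr_ge0 ?cabs_ge0.
move=> k _; apply: le_trans (ler_norm _) _; rewrite /window.
apply: le_trans (cabs_distB _ _) _; rewrite -mulrBr -sumrB cabsM cabs_natV.
apply: (@le_trans _ _ (H%:R^-1 * \sum_(h < H) M * H%:R * cabs (z - w))).
  apply: ler_wpM2l; first by rewrite invr_ge0.
  apply: le_trans (cabs_sum _ _ _) _; apply: ler_sum => h _.
  rewrite -mulrBr cabsM -mulrA; apply: ler_pM (aM _) _; rewrite ?cabs_ge0 //.
  rewrite cabs_distC; apply: le_trans (unimodular_expB _ w1 z1) _.
  by apply: ler_wpM2r; rewrite ?cabs_ge0 // ler_nat ltnW.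
apply: (mean_le_cst (x := fun=> _)) => //.
by rewrite !mulr_ge0 ?cabs_ge0.
Qed.

Lemma persistent_shift a M (eps : R) z : 0 <= M ->
  (forall k, cabs (a k) <= M) -> cabs z = 1 ->
  (persistent (fun k => a k.+1) eps z <-> persistent a eps z).
Proof.
move=> M0 aM z1.
have diff H n : `|window_mean (fun k => a k.+1) H z n - window_mean a H z n|
    <= 2 * M / n%:R.
  rewrite /window_mean -mulrBr normrM ger0_norm ?invr_ge0 // mulrC.
  apply: ler_wpM2r; first by rewrite invr_ge0.
  have -> : \sum_(k < n) window (fun k => a k.+1) H z k -
      \sum_(k < n) window a H z k = window a H z n - window a H z 0.
    have e k : window (fun k => a k.+1) H z k = window a H z k.+1.
      by rewrite /window; under eq_bigr do rewrite -addSn.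
    rewrite -[RHS](telescope_sumr (window a H z)) // big_mkord sumrB.
    by congr (_ - _); apply: eq_bigr => k _.
  have := window_le H n M0 aM z1; have := window_le H 0 M0 aM z1.
  have := window_ge0 a H z n; have := window_ge0 a H z 0.
  rewrite ler_norml; lra.
have half (b c : nat -> R[i]) :
    (forall H n, window_mean b H z n <= window_mean c H z n + 2 * M / n%:R) ->
    persistent b eps z -> persistent c eps z.
  move=> bc pb H H0 x xe; have [y /andP[xy ye]] : exists y, x < y < eps.
    by exists ((x + eps) / 2); lra.
  have yx0 : 0 < y - x by rewrite subr_gt0.
  apply: filterS2 (pb H H0 y ye) (near_div_nat_le (2 * M) yx0) => n h1 h2.
  by have := bc H n; lra.
split; apply: half => H n; have := diff H n; rewrite ler_norml; lra.
Qed.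

Lemma slack_le (e v w D A B : R) :
  e - v <= A -> v <= D / 2 -> w <= D / 2 -> A <= B + w -> e - D <= B.
Proof. lra. Qed.

Lemma dist_transfer (e w l x y x' y' : R) :
  `|l - x| <= e / 6 -> `|l - y| <= e / 6 -> w <= e / 3 ->
  x' <= x + w -> x <= x' + w -> y' <= y + w -> y <= y' + w -> `|x' - y'| <= e.
Proof. rewrite !ler_norml; lra. Qed.

(** This reduces a condition on uncountably many angles to a countable one, and
    so makes the choice of a persistent angle measurable. The window means are
    equicontinuous in the angle, so a persistent angle is approximated by
    rational ones; conversely approximate solutions accumulate, by compactness,
    at a persistent angle. *)
Lemma persistent_arcP a M (eps s : R) (c : rat) : 0 <= M ->
  (forall k, cabs (a k) <= M) ->
  (exists2 t : R, s <= t <= ratr c & persistent a eps (circle t)) <->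
  (forall j : nat, exists2 q : rat, s <= (ratr q : R) <= ratr c &
     forall H, (0 < H <= j)%N -> \forall n \near \oo,
       eps - j.+1%:R^-1 <= window_mean a H (circle (ratr q)) n).
Proof.
move=> M0 aM.
have mod_le (H : nat) (x : R) : 0 < x -> exists2 y, 0 < y & M * H%:R * y <= x.
  move=> x0; have MH1 : 0 < M * H%:R + 1 by rewrite ltr_pwDr ?mulr_ge0.
  exists (x / (M * H%:R + 1)); first exact: divr_gt0.
  by rewrite mulrCA ler_piMr ?ltW // ltr_pdivrMr // mul1r ltrDl.
split=> [[t /andP[st tc] pt] j | h].
  have j0 : 0 < (j.+1%:R^-1 / 2 : R) by rewrite divr_gt0 ?invr_gt0.
  have [y y0 My] := mod_le j _ j0.
  have [r r0 tr] := circle_continuous t y0.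
  have [q [sq qc qt]] : exists q : rat,
      [/\ s <= (ratr q : R), (ratr q : R) <= ratr c & `|ratr q - t| < r].
    have [tc'|ct] := ltP t (ratr c); last first.
      exists c; split=> //; first exact: le_trans tc.
      have -> : t = ratr c by apply/le_anti; rewrite tc ct.
      by rewrite subrr normr0.
    have [|q] := @rat_in_itvoo R t (Num.min (ratr c) (t + r)).
      by rewrite lt_min tc' ltrDl.
    rewrite in_itv /= lt_min => /and3P[tq qc qr]; exists q; split.
    - exact: le_trans st (ltW tq).
    - exact: ltW.
    - by rewrite gtr0_norm ?subr_gt0 // ltrBlDl.
  exists q; first by rewrite sq.
  move=> H /andP[H0 Hj].
  have lt_e : eps - j.+1%:R^-1 / 2 < eps by rewrite ltrBlDr ltrDl.
  apply: filterS (pt H H0 _ lt_e) => n h1.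
  have := window_mean_lipschitz H n M0 aM (cabs_circle (ratr q)) (cabs_circle t).
  have : M * H%:R * cabs (circle (ratr q) - circle t) <= j.+1%:R^-1 / 2.
    apply: le_trans My; apply: ler_pM; rewrite ?mulr_ge0 ?cabs_ge0 ?tr //.
    by apply: ler_wpM2l => //; rewrite ler_nat.
  exact: slack_le h1 (lexx _).
have /boolp.choice[q qP] : forall j, exists q : rat, s <= (ratr q : R) <= ratr c /\
    forall H, (0 < H <= j)%N -> \forall n \near \oo,
       eps - j.+1%:R^-1 <= window_mean a H (circle (ratr q)) n.
  by move=> j; have [q ? ?] := h j; exists q.
pose u j : R := ratr (q j).
have [t [tsc tu]] : (`[s, (ratr c : R)]%classic `&` cluster (u @ \oo)) !=set0.
  apply: (@segment_compact R s (ratr c)).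
  by exists 0%N => // j _ /=; rewrite in_itv /=; exact: (qP j).1.
move/cluster_eventuallyP : tu => tu.
exists t; first by move: tsc; rewrite /= in_itv.
move=> H H0 x xe; pose d := eps - x; have d0 : 0 < d by rewrite subr_gt0.
have d2 : 0 < d / 2 by rewrite divr_gt0.
have [y y0 My] := mod_le H _ d2.
have [r r0 tr] := circle_continuous t y0.
have r2 : 0 < r / 2 by rewrite divr_gt0.
have [p] := tu (r / 2) (maxn H (Num.truncn (2 / d))) r2.
rewrite geq_max => /andP[Hp dp] tup.
have Hp0 : (0 < H <= p)%N by rewrite H0.
apply: filterS ((qP p).2 H Hp0) => n h1.
have := window_mean_lipschitz H n M0 aM (cabs_circle t) (cabs_circle (u p)).
have : M * H%:R * cabs (circle t - circle (u p)) <= d / 2.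
  apply: le_trans My; apply: ler_wpM2l; first exact: mulr_ge0.
  rewrite cabs_distC; apply: tr; rewrite distrC.
  by apply: le_lt_trans tup _; lra.
have : p.+1%:R^-1 <= d / 2 :> R.
  rewrite -[leRHS]invrK lef_pV2 ?posrE ?invr_gt0 //.
  rewrite invf_div; apply: ltW; apply: lt_le_trans (truncnS_gt _) _.
  by rewrite ler_nat.
by rewrite -(subKr eps x) -/d => h2 h3 h4; exact: slack_le h1 h2 h3 h4.
Qed.

(** A persistent angle is isolated from the left among the persistent angles:
    otherwise infinitely many of them accumulate at it. *)
Lemma persistent_isolated a M (eps t : R) : 0 < eps -> 0 <= M ->
  (forall k, cabs (a k) <= M) -> 0 <= t < 1 ->
  exists2 s : rat, Num.max 0 (ratr s) <= t &
    forall u, Num.max 0 (ratr s) <= u < t -> ~ persistent a eps (circle u).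
Proof.
move=> e0 M0 aM /andP[t0 t1].
have [t_eq0|tn0] := eqVneq t 0.
  exists 0; rewrite t_eq0 rmorph0 maxxx // => u /andP[h1 h2].
  by rewrite ltNge h1 in h2.
have tp : 0 < t by rewrite lt_neqAle eq_sym tn0.
apply: contrapT => nex.
have acc (m : R) : 0 <= m < t -> exists2 u, m < u < t & persistent a eps (circle u).
  move=> /andP[m0 mt]; have [s] := rat_in_itvoo mt; rewrite in_itv /= => /andP[ms st].
  apply: contrapT => nu; apply: nex; exists s.
    by rewrite ge_max t0 ltW.
  move=> u; rewrite ge_max => /andP[/andP[u0 su] ut] pu; apply: nu; exists u => //.
  by rewrite ut (lt_le_trans ms su).
have many r : exists l : seq R, [/\ size l = r, uniq l,
    (forall u, u \in l -> 0 <= u < t) &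
    forall u, u \in l -> persistent a eps (circle u)].
  elim: r => [|r [l [sl ul lt lp]]]; first by exists [::].
  pose m := foldr Num.max 0 l.
  have lm u : u \in l -> u <= m.
    rewrite /m; elim: (l) => //= x s IH; rewrite inE le_max => /orP[/eqP ->|/IH ->].
      by rewrite lexx.
    by rewrite orbT.
  have m0t : 0 <= m < t.
    rewrite /m; elim: (l) (lt) => [_|x s IH lt'] /=; first by rewrite lexx tp.
    have /andP[x0 xt] := lt' x (mem_head _ _).
    have /andP[s0 st] : 0 <= foldr Num.max 0 s < t.
      by apply: IH => u us; apply: lt'; rewrite inE us orbT.
    by rewrite le_max x0 gt_max xt st.
  have [u /andP[mu ut] pu] := acc m m0t; exists (u :: l); split=> /=.
  - by rewrite sl.
  - rewrite ul andbT; apply/negP => /lm; rewrite leNgt.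
    by rewrite mu.
  - move=> v; rewrite inE => /orP[/eqP ->|/lt //].
    by rewrite ut andbT (le_trans _ (ltW mu)) //; case/andP: m0t.
  - by move=> v; rewrite inE => /orP[/eqP ->|/lp].
have [r0 hr0] := persistent_finite e0 M0 aM.
have [l [sl ul lt lp]] := many r0.+1.
have sz (j : 'I_r0.+1) : (j < size l)%N by rewrite sl.
have := hr0 r0.+1 (fun j => circle (nth 0 l j)).
rewrite ltnn => h; suff : false by [].
apply: h.
- by move=> j; exact: cabs_circle.
- move=> i j e; apply/val_inj/eqP; rewrite -(nth_uniq 0 (sz i) (sz j) ul); apply/eqP.
  have ltj k : 0 <= nth 0 l (k : 'I_r0.+1) < 1.
    by have /andP[-> h] := lt _ (mem_nth 0 (sz k)); exact: lt_trans h t1.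
  exact: circle_inj e.
- by move=> j; apply: lp; exact: mem_nth.
Qed.

(** Convergence of the window means passes from the rational angles to all
    frequencies, the means being equicontinuous in the frequency. *)
Lemma window_mean_cvg a M H t : 0 <= M -> (forall k, cabs (a k) <= M) ->
  (forall q : rat, cvgn (window_mean a H (circle (ratr q)))) ->
  cvgn (window_mean a H (circle t)).
Proof.
move=> M0 aM cq; apply: cauchy_cvgn_real => e e0.
have e3 : 0 < e / 3 by rewrite divr_gt0.
have MH1 : 0 < M * H%:R + 1 by rewrite ltr_pwDr ?mulr_ge0.
have [r r0 tr] := circle_continuous t (divr_gt0 e3 MH1).
have [|q] := @rat_in_itvoo R t (t + r); first by rewrite ltrDl.
rewrite in_itv /= => /andP[tq qr].
have dq : M * H%:R * cabs (circle (ratr q) - circle t) <= e / 3.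
  apply: le_trans (_ : M * H%:R * (e / 3 / (M * H%:R + 1)) <= _).
    apply: ler_wpM2l; first exact: mulr_ge0.
    by apply: tr; rewrite gtr0_norm ?subr_gt0 // ltrBlDl.
  by rewrite mulrCA ler_piMr ?ltW // ltr_pdivrMr // mul1r ltrDl.
have /cvg_ex[l /cvgrPdist_le hl] := cq q.
have e6 : 0 < e / 6 by rewrite divr_gt0.
have [N _ hN] := hl _ e6.
exists N => m n Nm Nn.
have lip k := window_mean_lipschitz H k M0 aM (cabs_circle (ratr q)) (cabs_circle t).
have lip' k := window_mean_lipschitz H k M0 aM (cabs_circle t) (cabs_circle (ratr q)).
apply: (dist_transfer (hN m Nm) (hN n Nn) dq) => //; rewrite cabs_distC; exact: lip'.
Qed.

End windows.

(** * The maximal ergodic theorem and Birkhoff's theorem *)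

Lemma cvgn_no_oscillation (R : realType) (u : nat -> R) (B : R) :
  (forall n, `|u n| <= B) ->
  (forall a b : rat, a < b ->
     ~ ((forall N, exists2 n, (N <= n)%N & u n < ratr a) /\
        (forall N, exists2 n, (N <= n)%N & ratr b < u n))) ->
  cvgn u.
Proof.
move=> uB nosc.
pose A := [set x : R | forall N, exists2 n, (N <= n)%N & x < u n].
have AB x : A x -> x <= B.
  move=> /(_ 0%N)[n _ xu]; apply: ltW; apply: lt_le_trans xu _.
  exact: le_trans (ler_norm _) (uB n).
have A0 : A (- B - 1).
  move=> N; exists N => //; have := uB N; rewrite ler_norml => /andP[+ _]; lra.
have hsA : has_sup A by split; [exists (- B - 1) | exists B => x; exact: AB].
apply/cvg_ex; exists (sup A); apply/cvgrPdist_le => e e0.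
have up : \forall n \near \oo, u n <= sup A + e.
  have : ~ A (sup A + e).
    by move=> /(ub_le_sup (proj2 hsA)); rewrite -subr_ge0; lra.
  move=> /existsNP[N /forall2NP nA]; exists N => // n /= Nn.
  by case: (nA n) => // /negP; rewrite -leNgt.
have dn : \forall n \near \oo, sup A - e <= u n.
  apply: contrapT => ndn.
  have e20 : 0 < e / 2 by rewrite divr_gt0.
  have [x Ax xsup] := sup_adherent e20 hsA.
  have [a /andP[a1 a2]] : exists a : rat, sup A - e < ratr a < sup A - e / 2.
    have [|a] := @rat_in_itvoo R (sup A - e) (sup A - e / 2); first lra.
    by rewrite in_itv /= => ?; exists a.
  have [b] : exists b : rat, (ratr a : R) < ratr b < sup A - e / 2.
    have [|b] := @rat_in_itvoo R (ratr a) (sup A - e / 2); first lra.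
    by rewrite in_itv /= => ?; exists b.
  rewrite ltr_rat => /andP[ab b2].
  apply: (nosc a b ab); split=> N.
    apply: contrapT => nex; apply: ndn; exists N => // n /= Nn.
    rewrite leNgt; apply/negP => un; apply: nex; exists n => //.
    exact: lt_trans un a1.
  have [n Nn xn] := Ax N; exists n => //.
  exact: lt_trans b2 (lt_trans xsup xn).
near=> n.
have h1 : u n <= sup A + e by near: n.
have h2 : sup A - e <= u n by near: n.
rewrite ler_norml; lra.
Unshelve. all: by end_near.
Qed.

Section birkhoff.
Context (R : realType) (d : measure_display) (T : measurableType d).
Variables (mu : {measure set T -> \bar R}) (tau : T -> T).
Hypothesis htau : measure_preserving mu tau.

Local Notation integ f := (mu.-integrable setT (EFin \o f)).

Let mtau : measurable_fun setT tau := proj1 htau.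

Lemma integrable_measurable (f : T -> R) : integ f -> measurable_fun setT f.
Proof. by move=> /integrableP[/measurable_EFinP]. Qed.

Lemma measurable_iter_tau k : measurable_fun setT (iter k tau).
Proof.
elim: k => [|k IH]; first exact: measurable_id.
exact: (measurableT_comp mtau IH).
Qed.

Lemma measure_preserving_pushforward (A : set T) :
  measurable A -> A `<=` setT -> pushforward mu tau A = mu A.
Proof. by move=> mA _; rewrite /pushforward (proj2 htau). Qed.

Lemma ge0_integral_measure_preserving (f : T -> \bar R) :
  measurable_fun setT f -> (forall x, 0 <= f x)%E ->
  (\int[mu]_x f (tau x) = \int[mu]_x f x)%E.
Proof.
move=> mf f0.
rewrite -[RHS](eq_measure_integral _ measure_preserving_pushforward).
by rewrite (ge0_integral_pushforward mtau).
Qed.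

Lemma integrable_measure_preserving (f : T -> R) : integ f -> integ (f \o tau).
Proof.
move=> /integrableP[mf fi]; apply/integrableP; split.
  exact: (measurableT_comp mf mtau).
rewrite (ge0_integral_measure_preserving (f := fun x => `|(f x)%:E|%E)) //.
exact: measurableT_comp.
Qed.

Lemma Rintegral_measure_preserving (f : T -> R) : integ f ->
  \int[mu]_x f (tau x) = \int[mu]_x f x.
Proof.
move=> fi; rewrite /Rintegral; congr fine.
rewrite -[RHS](eq_measure_integral _ measure_preserving_pushforward).
rewrite (integral_pushforward mtau) //; first exact: measurable_int fi.
by rewrite preimage_setT; exact: integrable_measure_preserving.
Qed.

Lemma integrable_add (f g : T -> R) : integ f -> integ g ->
  integ (fun x => f x + g x).
Proof. by move=> fi gi; exact: (integrableD measurableT fi gi). Qed.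

Lemma integrable_sub (f g : T -> R) : integ f -> integ g ->
  integ (fun x => f x - g x).
Proof. by move=> fi gi; exact: (integrableB measurableT fi gi). Qed.

Lemma integrable_dominated (f g : T -> R) : measurable_fun setT f -> integ g ->
  (forall x, `|f x| <= g x) -> integ f.
Proof.
move=> mf gi fg; apply: (le_integrable measurableT _ _ gi).
  exact/measurable_EFinP.
by move=> x _ /=; rewrite lee_fin (le_trans (fg x)) // ler_norm.
Qed.

Lemma integrable_normr (f : T -> R) : integ f -> integ (fun x => `|f x|).
Proof. by move=> /integrable_abse. Qed.

Lemma integrable_mul_indic (f : T -> R) (A : set T) : measurable A ->
  integ f -> integ (fun x => f x * \1_A x).
Proof.
move=> mA fi; apply: (integrable_dominated _ (integrable_normr fi)).
  apply: measurable_funM; [exact: integrable_measurable|exact: measurable_indic].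
move=> x; rewrite normrM indicE; case: (x \in A); last by rewrite normr0 mulr0.
by rewrite normr1 mulr1.
Qed.

Lemma integrable_indic_finite (A : set T) : measurable A -> (mu A < +oo)%E ->
  integ (\1_A : T -> R).
Proof.
move=> mA Afin; apply/integrableP; split; first exact/measurable_EFinP.
rewrite (eq_integral (fun x => (\1_A x)%:E)).
  by rewrite integral_indic // setIT.
by move=> t _; rewrite /= ger0_norm // indicE ler0n.
Qed.

(** The maximum of the Birkhoff sums S_0 f, ..., S_N f. The recursion says that
    M_{N+1} = max(0, f + M_N o tau), which is what Garsia's argument needs. *)
Fixpoint maximal_sum (f : T -> R) (N : nat) (w : T) : R :=
  if N is N'.+1 then Num.max 0 (f w + maximal_sum f N' (tau w)) else 0.

Definition birkhoff_sum (f : T -> R) (n : nat) (w : T) : R :=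
  \sum_(k < n) f (iter k tau w).

Lemma birkhoff_sumS f n w :
  birkhoff_sum f n.+1 w = f w + birkhoff_sum f n (tau w).
Proof.
rewrite /birkhoff_sum big_ord_recl /=; congr (_ + _).
by apply: eq_bigr => k _; rewrite -iterSr.
Qed.

Lemma measurable_birkhoff_sum f n : measurable_fun setT f ->
  measurable_fun setT (birkhoff_sum f n).
Proof.
move=> mf; apply: measurable_sum => k.
exact: (measurableT_comp mf (measurable_iter_tau k)).
Qed.

Lemma integrable_birkhoff_sum f n : integ f -> integ (birkhoff_sum f n).
Proof.
move=> fi; elim: n => [|n IH].
  rewrite (_ : birkhoff_sum f 0 = cst 0); first exact: integrable0.
  by apply/funext => w; rewrite /birkhoff_sum big_ord0.
rewrite (_ : birkhoff_sum f n.+1 =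
  (fun w => f w + (birkhoff_sum f n \o tau) w)).
  exact: integrable_add (integrable_measure_preserving IH).
by apply/funext => w; rewrite birkhoff_sumS.
Qed.

Lemma maximal_sum_ge0 f N w : 0 <= maximal_sum f N w.
Proof. by case: N => //= N; rewrite le_max lexx. Qed.

Lemma maximal_sum_leS f N w : maximal_sum f N w <= maximal_sum f N.+1 w.
Proof.
elim: N w => [|N IH] w; first by rewrite maximal_sum_ge0.
rewrite [leRHS]/= [leLHS]/= ge_max !le_max lexx /=.
by rewrite lerD2l IH orbT.
Qed.

Lemma maximal_sum_le f N M w : (N <= M)%N ->
  maximal_sum f N w <= maximal_sum f M w.
Proof.
by move=> NM; apply: (nondecreasing_seqP (maximal_sum f ^~ w)).1 => // n;
   exact: maximal_sum_leS.
Qed.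

Lemma birkhoff_sum_le_maximal f n N w : (n <= N)%N ->
  birkhoff_sum f n w <= maximal_sum f N w.
Proof.
elim: N n w => [|N IH] [|n] w //; rewrite ?[birkhoff_sum f 0 w]big_ord0 //.
- by rewrite maximal_sum_ge0.
- by rewrite birkhoff_sumS /= ltnS => nN; rewrite le_max lerD2l IH // orbT.
Qed.

Lemma integrable_maximal_sum f N : integ f -> integ (maximal_sum f N).
Proof.
move=> fi; elim: N => [|N IH]; first exact: integrable0.
have gi : integ (fun w => f w + (maximal_sum f N \o tau) w).
  exact: integrable_add (integrable_measure_preserving IH).
apply: (integrable_dominated _ (integrable_normr gi)).
  by apply: measurable_maxr => //; exact: integrable_measurable.
move=> w /=; rewrite ger0_norm ?le_max ?lexx //.
by rewrite ge_max normr_ge0 ler_norm.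
Qed.

Lemma measurable_gt (f : T -> R) (c : R) : measurable_fun setT f ->
  measurable [set w | c < f w].
Proof.
move=> mf; rewrite (_ : [set w | c < f w] = setT `&` f @^-1` `]c, +oo[).
  by apply: mf => //; exact: measurable_itv.
by rewrite setTI; apply/seteqP; split=> w /=; rewrite in_itv /= andbT.
Qed.

Lemma measurable_maximal_gt0 f N : integ f ->
  measurable [set w | 0 < maximal_sum f N w].
Proof.
by move=> fi; apply: measurable_gt; apply: integrable_measurable;
   exact: integrable_maximal_sum.
Qed.

(** The maximal ergodic theorem, by Garsia's argument: on [maximal_sum f N > 0]
    the function f is at least the coboundary M_N - M_N o tau, whose integral
    vanishes. *)
Theorem maximal_ergodic f N : integ f ->
  0 <= \int[mu]_w (f w * \1_[set w | 0 < maximal_sum f N w] w).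
Proof.
move=> fi.
have iM := integrable_maximal_sum N fi.
have iMt := integrable_measure_preserving iM.
apply: (@le_trans _ _
  (\int[mu]_w (maximal_sum f N w - maximal_sum f N (tau w)))).
  by rewrite RintegralB // Rintegral_measure_preserving // subrr.
apply: le_Rintegral => //.
- exact: integrable_sub.
- exact: integrable_mul_indic (measurable_maximal_gt0 N fi) fi.
move=> w _; rewrite indicE /=; 

have [Mw|Mw] := ltP 0 (maximal_sum f N w).
  rewrite mem_set // mulr1.
  case: N Mw {iM iMt} => [|N] Mw; first by rewrite ltxx in Mw.
  have MN := maximal_sum_leS f N (tau w).
  move: Mw MN => /=; rewrite lt_max ltxx /= => Mw MN.
  by rewrite (max_r (ltW Mw)); lra.
rewrite memNset ?mulr0 ?subr_le0 /=; last by apply/negP; rewrite -leNgt.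
exact: le_trans Mw (maximal_sum_ge0 _ _ _).
Qed.

Lemma integrable_level_finite (g : T -> R) (b : R) : integ g -> 0 < b ->
  (mu [set w | (b <= `|g w|)%R] < +oo)%E.
Proof.
move=> gi b0; have mg := integrable_measurable gi.
have := @le_integral_comp_abse _ _ _ mu setT measurableT (EFin \o g) b id
  (@measurable_id _ _ _) (fun _ h => h) (fun _ _ _ _ h => h)
  ((measurable_EFinP _ _).2 mg) b0.
rewrite setTI => /le_lt_trans /(_ (integrableP _ _ _ gi).2) h.
rewrite ltNge leye_eq; apply/negP => /eqP E.
rewrite (_ : [set x | _] = [set w | b <= `|g w|]) ?E in h; last first.
  by apply/seteqP; split=> w /=; rewrite lee_fin.
by rewrite gt0_muley ?lte_fin // ltxx in h.
Qed.

Definition exceedance (f : T -> R) (b : R) (N : nat) : set T :=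
  [set w | exists2 n, (0 < n <= N)%N & b * n%:R < birkhoff_sum f n w].

Lemma measurable_exceedance f b N : measurable_fun setT f ->
  measurable (exceedance f b N).
Proof.
move=> mf; rewrite (_ : exceedance f b N =
    \bigcup_(n in [set n | (0 < n <= N)%N])
       [set w | b * n%:R < birkhoff_sum f n w]).
  apply: bigcup_measurable => n _; apply: measurable_gt.
  exact: measurable_birkhoff_sum.
by apply/seteqP; split=> w [n nN h]; exists n.
Qed.

Lemma exceedance_finite f b N : integ f -> 0 < b ->
  (mu (exceedance f b N) < +oo)%E.
Proof.
move=> fi b0; pose G w := \sum_(n < N.+1) `|birkhoff_sum f n w|.
have iG : integ G.
  rewrite (_ : EFin \o G =
    fun w => (\sum_(n < N.+1) `|birkhoff_sum f n w|%:E)%E).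
    apply: integrable_sum => // n _.
    exact/integrable_normr/integrable_birkhoff_sum.
  by apply/funext => w; rewrite /= sumEFin.
apply: le_lt_trans (integrable_level_finite iG b0); apply: le_measure.
- by rewrite inE; apply: measurable_exceedance; exact: integrable_measurable.
- rewrite inE -[X in measurable X]setTI.
  by apply: (measurable_fun_ler (measurable_cst b)
    (measurableT_comp (@normr_measurable _ _) (integrable_measurable iG))
    measurableT (Y := [set true])).
move=> w [n /andP[n0 nN]] bS /=; rewrite ger0_norm ?sumr_ge0 //.
rewrite /G (bigD1 (Ordinal (nN : n < N.+1)%N)) //=.
apply: ler_wpDr; first exact: sumr_ge0.
apply: le_trans (ler_norm _); apply: le_trans (ltW bS).
by rewrite -[leLHS]mulr1 ler_pM2l // ler1n.
Qed.

(** The maximal inequality with a threshold: subtracting b on the set where some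
    average exceeds b makes the maximal sum positive there. *)
Lemma exceedance_weak_type f (b : R) N : integ f -> 0 < b ->
  (mu (exceedance f b N) <= (b^-1 * \int[mu]_w `|f w|)%:E)%E.
Proof.
move=> fi b0; set E := exceedance f b N.
have mE : measurable E.
  by apply: measurable_exceedance; exact: integrable_measurable.
have Efin : (mu E < +oo)%E by exact: exceedance_finite.
have iE : integ (\1_E : T -> R) by exact: integrable_indic_finite.
have ibE : integ (fun w => b * \1_E w) by exact: (integrableZl measurableT b iE).
have ig : integ (fun w => f w - b * \1_E w) by exact: integrable_sub.
have := maximal_ergodic N ig.
set P := [set w | _] => posP.
have EP : E `<=` P.
  move=> w Ew; have [n /andP[n0 nN] bS] := Ew.
  apply: lt_le_trans (birkhoff_sum_le_maximal _ w nN).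
  rewrite /birkhoff_sum sumrB subr_gt0; apply: le_lt_trans bS.
  rewrite -mulr_sumr ler_pM2l //.
  rewrite -[n in leRHS]card_ord -sum1_card natr_sum; apply: ler_sum => k _.
  by rewrite indicE; case: (_ \in _).
have mP : measurable P by exact: measurable_maximal_gt0.
have : 0 <= \int[mu]_w (`|f w| - b * \1_E w).
  apply: le_trans posP _; apply: le_Rintegral => //.
  - exact: integrable_mul_indic.
  - exact/integrable_sub/ibE/integrable_normr.
  move=> w _; rewrite !indicE.
  have [/EP wP|nwE] := pselect (E w).
    by rewrite (mem_set wP) mulr1 lerD2r ler_norm.
  rewrite (memNset nwE) mulr0 !subr0.
  by case: (w \in P); rewrite ?mulr1 ?mulr0 ?normr_ge0 ?ler_norm.
rewrite RintegralB //; last exact: integrable_normr.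
rewrite RintegralZl // subr_ge0 => h.
have {}h : b * fine (mu E) <= \int[mu]_w `|f w|.
  by move: h; rewrite /Rintegral integral_indic // setIT.
rewrite -(@fineK _ (mu E)) ?ge0_fin_numE // lee_fin.
by rewrite ler_pdivlMl.
Qed.

Theorem maximal_inequality f (b : R) : integ f -> 0 < b ->
  measurable (\bigcup_N exceedance f b N) /\
  (mu (\bigcup_N exceedance f b N) <= (b^-1 * \int[mu]_w `|f w|)%:E)%E.
Proof.
move=> fi b0.
have mE N : measurable (exceedance f b N).
  by apply: measurable_exceedance; exact: integrable_measurable.
have mU : measurable (\bigcup_N exceedance f b N).
  by apply: bigcup_measurable => N _.
split=> //.
have cv : mu (exceedance f b N) @[N --> \oo] -->
    mu (\bigcup_N exceedance f b N).
  apply: nondecreasing_cvg_mu => // N M NM; apply/subsetPset => w.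
  by move=> [n /andP[n0 nN] h]; exists n; rewrite ?n0 ?(leq_trans nN).
rewrite -(cvg_lim _ cv) //; apply: lime_le; first by apply/cvg_ex; eexists; exact: cv.
by apply: nearW => N; exact: exceedance_weak_type.
Qed.

(** Dominated convergence in [maximal_ergodic]: the sets where M_N > 0 increase
    with N to a set that contains the support of g. *)
Lemma integral_ge0_of_maximal g : integ g ->
  (forall w, g w != 0 -> exists N, 0 < maximal_sum g N w) ->
  0 <= \int[mu]_w g w.
Proof.
move=> gi gM.
pose P N := [set w | 0 < maximal_sum g N w].
have mP N : measurable (P N) by exact: measurable_maximal_gt0.
have cv : (fun N => \int[mu]_w (g w * \1_(P N) w)%:E)%E @ \oo -->
    (\int[mu]_w ((g w)%:E))%E.
  have [] := @dominated_convergence _ T R mu setT measurableT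
    (fun N w => (g w * \1_(P N) w)%:E) (EFin \o g) (fun w => `|g w|%:E) => //.
  - move=> N; apply/measurable_EFinP/measurable_funM; last exact: measurable_indic.
    exact: integrable_measurable.
  - exact/measurable_EFinP/integrable_measurable.
  - apply: aeW => w _; apply: cvg_near_cst.
    have [/eqP g0|/gM[N0 MN0]] := boolP (g w == 0).
      by near=> N; rewrite /= g0 mul0r.
    exists N0 => // N /= NN0; rewrite indicE mem_set ?mulr1 //=.
    exact: lt_le_trans MN0 (maximal_sum_le _ _ NN0).
  - exact: integrable_normr.
  - apply: aeW => w N _ /=; rewrite lee_fin normrM indicE.
    by case: (w \in _); rewrite ?normr1 ?mulr1 // normr0 mulr0.
rewrite /Rintegral fine_ge0 // -(cvg_lim _ cv) //.
apply: lime_ge; first by apply/cvg_ex; eexists; exact: cv.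
apply: nearW => N.
have fN : (\int[mu]_w (g w * \1_(P N) w)%:E)%E \is a fin_num.
  exact: (integrable_fin_num measurableT (integrable_mul_indic (mP N) gi)).
by rewrite -(fineK fN) lee_fin; exact: maximal_ergodic.
Unshelve. all: by end_near.
Qed.

(** Oscillation is expressed through unbounded Birkhoff sums because this makes
    the invariance under tau exact and immediate. *)
Definition unbounded_sums (g : T -> R) : set T :=
  [set w | forall K : nat, exists n, K%:R < birkhoff_sum g n w].

Lemma measurable_unbounded_sums g : measurable_fun setT g ->
  measurable (unbounded_sums g).
Proof.
move=> mg; rewrite (_ : unbounded_sums g =
  \bigcap_K \bigcup_n [set w | K%:R < birkhoff_sum g n w]).
  apply: bigcap_measurable => // K _; apply: bigcup_measurable => n _.
  exact/measurable_gt/measurable_birkhoff_sum.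
apply/seteqP; split=> w /= h K; first by have [n hn] := h K; exists n.
by have [n _ hn] := h K I; exists n.
Qed.

Lemma unbounded_sums_invariant g w :
  unbounded_sums g (tau w) <-> unbounded_sums g w.
Proof.
split=> h K.
  have [n] := h (K + Num.truncn `|g w|).+1.
  rewrite -addnS natrD => hn; exists n.+1; rewrite birkhoff_sumS.
  have := truncnS_gt `|g w|; have := ler_norm (- g w); rewrite normrN; lra.
have [[|n]] := h (K + (Num.truncn `|g w|).+1)%N.
  rewrite /birkhoff_sum big_ord0 => h0.
  by have := ler0n R (K + (Num.truncn `|g w|).+1); rewrite leNgt h0.
rewrite birkhoff_sumS natrD => hn; exists n.
have := truncnS_gt `|g w|; have := ler_norm (g w); lra.
Qed.

Lemma birkhoff_sum_mul_invariant g (E : set T) n w :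
  (forall w, E (tau w) <-> E w) ->
  birkhoff_sum (fun w => g w * \1_E w) n w = birkhoff_sum g n w * \1_E w.
Proof.
move=> invE; elim: n w => [|n IH] w.
  by rewrite /birkhoff_sum !big_ord0 mul0r.
rewrite !birkhoff_sumS IH mulrDl; congr (_ + _ * _).
rewrite !indicE; congr (_%:R); congr nat_of_bool.
by apply/idP/idP; rewrite !inE => /invE.
Qed.

Lemma integral_ge0_unbounded g (E : set T) : measurable E ->
  (forall w, E (tau w) <-> E w) -> E `<=` unbounded_sums g ->
  integ (fun w => g w * \1_E w) -> 0 <= \int[mu]_w (g w * \1_E w).
Proof.
move=> mE invE Eub gi; apply: integral_ge0_of_maximal => // w.
rewrite indicE; have [Ew _|nEw] := pselect (E w); last first.
  by rewrite memNset // mulr0 eqxx.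
have [n hn] := Eub w Ew 0%N; exists n.
apply: lt_le_trans (birkhoff_sum_le_maximal _ w (leqnn n)).
by rewrite birkhoff_sum_mul_invariant // indicE mem_set // mulr1.
Qed.

Lemma birkhoff_sum_sub_cst f (b : R) n w :
  birkhoff_sum (fun w => f w - b) n w = birkhoff_sum f n w - b * n%:R.
Proof.
by rewrite /birkhoff_sum sumrB sumr_const card_ord mulr_natr.
Qed.

Lemma birkhoff_sum_opp f n w :
  birkhoff_sum (fun w => - f w) n w = - birkhoff_sum f n w.
Proof. by rewrite /birkhoff_sum sumrN. Qed.

(** The set is invariant, and it has finite measure by the maximal inequality
    since b > 0. Hence f - b and a - f are integrable on it, with nonnegative
    integrals, and adding them shows that (a - b) times its measure is
    nonnegative. *)
Lemma oscillation_null_pos f (a b : R) : integ f -> a < b -> 0 < b ->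
  mu (unbounded_sums (fun w => f w - b) `&` unbounded_sums (fun w => a - f w))
    = 0%E.
Proof.
move=> fi ab b0; set E := _ `&` _.
have mf := integrable_measurable fi.
have mE : measurable E.
  by apply: measurableI; apply: measurable_unbounded_sums;
     exact: measurable_funB.
have invE w : E (tau w) <-> E w.
  by split=> -[h1 h2]; split; exact/unbounded_sums_invariant.
have Efin : (mu E < +oo)%E.
  have [mU /le_lt_trans h] := maximal_inequality fi b0.
  apply: le_lt_trans (h _ (ltry _)); apply: le_measure; rewrite ?inE //.
  move=> w [/(_ 0%N)[n hn] _]; exists n => //; exists n; last first.
    by move: hn; rewrite birkhoff_sum_sub_cst; lra.
  rewrite leqnn andbT lt0n; apply: contraTneq hn => ->.
  by rewrite /birkhoff_sum big_ord0 ltxx.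
have iE := integrable_indic_finite mE Efin.
have ifE := integrable_mul_indic mE fi.
have icE (c : R) : integ (fun w => c * \1_E w) by exact: (integrableZl measurableT c iE).
have e1 : (fun w => (f w - b) * \1_E w) = (fun w => f w * \1_E w - b * \1_E w).
  by apply/funext => w; rewrite mulrBl.
have e2 : (fun w => (a - f w) * \1_E w) = (fun w => a * \1_E w - f w * \1_E w).
  by apply/funext => w; rewrite mulrBl.
have h1 : 0 <= \int[mu]_w ((f w - b) * \1_E w).
  apply: integral_ge0_unbounded => //; first by move=> w [].
  by rewrite e1; exact: integrable_sub.
have h2 : 0 <= \int[mu]_w ((a - f w) * \1_E w).
  apply: integral_ge0_unbounded => //; first by move=> w [].
  by rewrite e2; exact: integrable_sub.
rewrite e1 RintegralB // RintegralZl // in h1.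
rewrite e2 RintegralB // RintegralZl // in h2.
have E1 : \int[mu]_w \1_E w = fine (mu E).
  by rewrite /Rintegral integral_indic // setIT.
rewrite !E1 in h1 h2.
have : (b - a) * fine (mu E) <= 0 by rewrite mulrBl; lra.
rewrite pmulr_rle0 ?subr_gt0 // => h.
have -> : mu E = (fine (mu E))%:E by rewrite fineK // ge0_fin_numE.
congr EFin; apply/eqP; rewrite eq_le h /=; exact: fine_ge0.
Qed.

Lemma oscillation_null f (a b : R) : integ f -> a < b ->
  mu (unbounded_sums (fun w => f w - b) `&` unbounded_sums (fun w => a - f w))
    = 0%E.
Proof.
move=> fi ab; have [b0|b0] := ltP 0 b; first exact: oscillation_null_pos.
have a0 : a < 0 by exact: lt_le_trans ab b0.
have nfi : integ (fun w => - f w).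
  by have := integrableN fi; apply: eq_integrable.
have := @oscillation_null_pos _ (- b) (- a) nfi.
rewrite ltrN2 oppr_gt0 => /(_ ab a0); rewrite setIC.
rewrite (_ : (fun w => - b - - f w) = (fun w => f w - b)); last first.
  by apply/funext => w; rewrite opprK addrC.
by rewrite (_ : (fun w => - f w - - a) = (fun w => a - f w)) //;
   apply/funext => w; rewrite opprK addrC.
Qed.

(** Birkhoff's pointwise ergodic theorem: the averages are almost everywhere
    bounded by the maximal inequality for |f|, and for each pair of rational
    levels the set where they oscillate across both is null. *)
Theorem birkhoff f : integ f ->
  {ae mu, forall w, cvgn (fun n => n%:R^-1 * birkhoff_sum f n w)}.
Proof.
move=> fi.
have mf := integrable_measurable fi.
have inorm := integrable_normr fi.
have osc (ab : rat * rat) : {ae mu, forall w, ab.1 < ab.2 ->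
    ~ (unbounded_sums (fun w => f w - ratr ab.2) w /\
       unbounded_sums (fun w => ratr ab.1 - f w) w)}.
  have [lt_ab|nab] := boolP (ab.1 < ab.2); last first.
    exact: aeW.
  exists (unbounded_sums (fun w => f w - ratr ab.2) `&`
          unbounded_sums (fun w => ratr ab.1 - f w)); split.
  - by apply: measurableI; apply: measurable_unbounded_sums;
      exact: measurable_funB.
  - by apply: oscillation_null => //; rewrite ltr_rat.
  - by move=> w /= /not_implyP[_ /contrapT].
have bnd : {ae mu, forall w, exists b : R, forall n,
    birkhoff_sum (fun w => `|f w|) n w <= b * n%:R}.
  pose Z := \bigcap_(b : nat) \bigcup_N exceedance (fun w => `|f w|) b.+1%:R N.
  have mZb (b : nat) := maximal_inequality inorm (ltr0Sn R b).
  exists Z; split.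
  - by apply: bigcap_measurable => // b _; exact: (mZb b).1.
  - apply/eqP; rewrite -measure_le0; apply/lee_addgt0Pr => e e0; rewrite add0e.
    set J := \int[mu]_w `| `|f w| |.
    have J0 : 0 <= J by exact: Rintegral_ge0.
    pose b := Num.truncn (J / e).
    apply: (@le_trans _ _ (mu (\bigcup_N exceedance (fun w => `|f w|) b.+1%:R N))).
      apply: le_measure; rewrite ?inE.
      - by apply: bigcap_measurable => // c _; exact: (mZb c).1.
      - exact: (mZb b).1.
      - by move=> w; apply.
    apply: le_trans (mZb b).2 _; rewrite lee_fin ler_pdivrMl //.
    by rewrite -ler_pdivrMr // ltW // truncnS_gt.
  - move=> w /= nw b _; apply: contrapT => nex; apply: nw.
    exists b.+1%:R => n; rewrite leNgt; apply/negP => h; apply: nex.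
    exists n => //; exists n => //; rewrite leqnn andbT lt0n.
    by apply: contraTneq h => ->; rewrite /birkhoff_sum big_ord0 mulr0 ltxx.
have {}osc : {ae mu, forall w (ab : rat * rat), ab.1 < ab.2 ->
    ~ (unbounded_sums (fun w => f w - ratr ab.2) w /\
       unbounded_sums (fun w => ratr ab.1 - f w) w)}.
  pose g (k : nat) : rat * rat := odflt (0, 0) (unpickle k).
  have := ae_foralln (fun k => osc (g k)); apply: filterS => w h ab.
  by have := h (pickle ab); rewrite /g pickleK.
apply: filterS2 bnd osc => w [B SB] nosc.
have avgB n : `|n%:R^-1 * birkhoff_sum f n w| <= `|B|.
  rewrite normrM ger0_norm ?invr_ge0 //.
  case: n => [|n]; first by rewrite invr0 mul0r.
  rewrite ler_pdivrMl ?ltr0Sn //.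
  apply: (@le_trans _ _ (birkhoff_sum (fun w => `|f w|) n.+1 w)).
    exact: ler_norm_sum.
  apply: le_trans (SB _) _; rewrite mulrC ler_pM2l ?ltr0Sn //; exact: ler_norm.
(* an average that stays a definite distance above b forces the sums of f - b
   to be unbounded *)
have unb (g : T -> R) (x y : R) : x < y ->
    (forall N, exists2 n, (N <= n)%N & y < n%:R^-1 * birkhoff_sum g n w) ->
    unbounded_sums (fun w => g w - x) w.
  move=> xy fr K; pose N := (Num.truncn (K%:R / (y - x))).+1.
  have [n Nn yn] := fr N; exists n; rewrite birkhoff_sum_sub_cst.
  have n0 : 0 < n%:R :> R by rewrite ltr0n (leq_trans _ Nn).
  have : K%:R < (y - x) * n%:R.
    rewrite -ltr_pdivrMl ?subr_gt0 // mulrC.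
    by apply: lt_le_trans (truncnS_gt _) _; rewrite ler_nat.
  move: yn; rewrite ltr_pdivlMl // mulrBl; lra.
apply: (@cvgn_no_oscillation _ _ `|B|) => // a b ab [frb fra].
have [c] : exists c : rat * rat, [/\ a < c.1, c.1 < c.2 & c.2 < b].
  exists (a + (b - a) / 3%:R, a + (b - a) * 2%:R / 3%:R) => /=; split; lra.
(* The rational levels c.1 < c.2 lie strictly between a and b, as [unb]
   requires. *)
move=> [ac cc cb]; apply: (nosc c cc); split.
  by apply: unb fra; rewrite ltr_rat.
have := @unb (fun w => - f w) (- ratr c.1) (- ratr a).
rewrite ltrN2 ltr_rat => /(_ ac).
rewrite (_ : (fun w => - f w - - ratr c.1) = (fun w => ratr c.1 - f w)); last first.
  by apply/funext => z; rewrite opprK addrC.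
apply=> N; have [n Nn h] := frb N; exists n => //.
by rewrite birkhoff_sum_opp mulrN ltrN2.
Qed.
End birkhoff.

(** * Averages with an invariant random frequency *)

Section rotation.
Context (R : realType).
Local Notation leb := (@lebesgue_measure R).

Lemma lebesgue_measure_translation (c : R) (A : set (measurableTypeR R)) :
  measurable A -> leb ((fun x => x + c) @^-1` A) = leb A.
Proof.
move=> mA; apply/esym.
have mc : measurable_fun setT (fun x : measurableTypeR R => x + c : measurableTypeR R).
  by apply: measurable_funD => //; exact: measurable_cst.
pose nu : {measure set (measurableTypeR R) -> \bar R} :=
  measure_function_pushforward__canonical__measure_function_Measure leb mc.
apply: (@lebesgue_measure_unique _ nu _ _ mA) => X [[a b] _ <-].
rewrite /= /pushforward.
rewrite (_ : _ @^-1` _ = `]a - c, b - c]%classic); last first.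
  by apply/seteqP; split=> x /=; rewrite !in_itv /= ltrBlDr lerBrDr.
rewrite !lebesgue_measure_itv /= !lte_fin ltrD2r.
by case: ifP => // _; rewrite -!EFinB; congr EFin; ring.
Qed.

(** Rotation by theta of the circle [0, 1[, extended by the identity so that it
    acts on the whole line with Lebesgue measure. *)
Definition rotation (theta t : R) : R :=
  if (0 <= t) && (t < 1) then
    if t + theta < 1 then t + theta else t + (theta - 1)
  else t.

Lemma rotation_unit theta t : 0 <= theta <= 1 -> 0 <= t < 1 ->
  0 <= rotation theta t < 1.
Proof.
move=> /andP[h0 h1] /andP[t0 t1]; rewrite /rotation t0 t1 /=.
case: ltP; lra.
Qed.

Lemma circle_rotation theta t : 0 <= t < 1 ->
  circle (rotation theta t) = circle theta * circle t.
Proof.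
move=> t01; rewrite /rotation t01; case: ifP => _.
  by rewrite circleD mulrC.
by rewrite !circleD circleN1 mulr1 mulrC.
Qed.

Lemma rotation_preserves theta (A : set (measurableTypeR R)) :
  0 <= theta <= 1 -> measurable A -> leb (rotation theta @^-1` A) = leb A.
Proof.
move=> /andP[h0 h1] mA.
pose A1 := A `&` `[theta, 1[; pose A2 := A `&` `[0, theta[.
pose A3 := A `&` ~` `[0, 1[.
have mA1 : measurable A1 by apply: measurableI => //; exact: measurable_itv.
have mA2 : measurable A2 by apply: measurableI => //; exact: measurable_itv.
have mA3 : measurable A3.
  by apply: measurableI => //; apply: measurableC; exact: measurable_itv.
pose B1 := (fun x => x + theta) @^-1` A1.
pose B2 := (fun x => x + (theta - 1)) @^-1` A2.
have mc (c : R) : measurable_fun setT (fun x : measurableTypeR R => x + c : measurableTypeR R).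
  by apply: measurable_funD => //; exact: measurable_cst.
have mB1 : measurable B1 by rewrite /B1 -[X in measurable X]setTI; exact: mc.
have mB2 : measurable B2 by rewrite /B2 -[X in measurable X]setTI; exact: mc.
have eB : rotation theta @^-1` A = B1 `|` B2 `|` A3.
  apply/seteqP; split=> t.
    rewrite /= /rotation; have [t01|nt] := boolP ((0 <= t) && (t < 1)).
      move: t01 => /andP[t0 t1]; case: ltP => tt At; left; [left|right].
        by split=> //=; rewrite in_itv /=; lra.
      by split=> //=; rewrite in_itv /=; lra.
    by move=> At; right; split=> //=; rewrite in_itv /=; exact/negP.
  rewrite /= /rotation => -[[[At]|[At]]|[At]] /=; rewrite in_itv /=.
  - move=> /andP[? ?]; have t01 : (0 <= t) && (t < 1) by lra.
    have tt : t + theta < 1 by lra.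
    by rewrite t01 tt.
  - move=> /andP[? ?]; have t01 : (0 <= t) && (t < 1) by lra.
    have tt : (t + theta < 1) = false by apply/negbTE; rewrite -leNgt; lra.
    by rewrite t01 tt.
  - by move=> /negP/negbTE ->.
have eA : A = A1 `|` A2 `|` A3.
  apply/seteqP; split=> t; last by move=> [[[]|[]]|[]].
  move=> At; have [t01|nt] := boolP ((0 <= t) && (t < 1)); last first.
    by right; split=> //=; rewrite in_itv /=; exact/negP.
  move: t01 => /andP[t0 t1]; left.
  by have [ht|ht] := leP theta t; [left|right]; split=> //=; rewrite in_itv /= ?ht ?t0 ?t1.
rewrite eB [in RHS]eA !measureU //; try exact: measurableU.
- by congr (_ + _ + _)%E; exact: lebesgue_measure_translation.
- apply/seteqP; split=> // t [[_ /= +] [_ /= +]]; rewrite !in_itv /=; lra.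
- apply/seteqP; split=> // t [[[_ /= +]|[_ /= +]] [_ /= /negP]]; rewrite !in_itv /=; lra.
- apply/seteqP; split=> // t [[_ /= +] [_ /= +]]; rewrite !in_itv /=; lra.
- apply/seteqP; split=> // t [[[_ /= +]|[_ /= +]] [_ /= /negP]]; rewrite !in_itv /=; lra.
Qed.

End rotation.

Section skew_product.
Context (R : realType) (d : measure_display) (T : measurableType d).
Variables (mu : {sigma_finite_measure set T -> \bar R}) (tau : T -> T).
Hypothesis htau : measure_preserving mu tau.
Variable angle : T -> R.
Hypothesis mangle : measurable_fun setT angle.
Hypothesis angle01 : forall w, 0 <= angle w <= 1.
Hypothesis angle_inv : forall w, angle (tau w) = angle w.

Local Notation leb := (@lebesgue_measure R).
Local Notation TR := (T * measurableTypeR R)%type.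

Definition skew (p : TR) : TR := (tau p.1, rotation (angle p.1) p.2).

Lemma measurable_skew : measurable_fun setT skew.
Proof.
have m1 : measurable_fun setT (fst : TR -> T) by exact: measurable_fst.
have m2 : measurable_fun setT (snd : TR -> measurableTypeR R).
  exact: measurable_snd.
have ma := measurableT_comp mangle m1.
apply: measurable_fun_pair; first exact: (measurableT_comp (proj1 htau) m1).
apply: measurable_fun_ifT => //.
  apply: measurable_and; first exact: measurable_fun_ler.
  exact: measurable_fun_ltr.
apply: measurable_fun_ifT.
- by apply: measurable_fun_ltr => //; exact: measurable_funD.
- exact: measurable_funD.
- by apply: measurable_funD => //; exact: measurable_funB.
Qed.

Lemma skew_measure_preserving : measure_preserving (mu \x leb)%E skew.
Proof.
split; first exact: measurable_skew.
move=> A mA; rewrite /product_measure1.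
rewrite -[RHS](ge0_integral_measure_preserving htau) //; last first.
  exact: measurable_fun_xsection.
apply: eq_integral => w _ /=.
rewrite -[RHS](rotation_preserves (angle01 w)); last exact: measurable_xsection.
congr (leb _); apply/seteqP; split=> t; rewrite /xsection /= !inE //.
Qed.

Lemma integrable_skew_cutoff (h : T -> R) :
  mu.-integrable setT (EFin \o h) -> (forall w, 0 <= h w) ->
  (mu \x leb)%E.-integrable setT
    (EFin \o (fun p : TR => h p.1 * \1_(`[0, 1[%classic : set R) p.2)).
Proof.
move=> hi h0.
have mh : measurable_fun setT h := integrable_measurable hi.
have m01 : measurable (`[0, 1[%classic : set (measurableTypeR R)).
  exact: measurable_itv.
have mF : measurable_fun setT
    (fun p : TR => h p.1 * \1_(`[0, 1[%classic : set R) p.2).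
  apply: measurable_funM; first exact: (measurableT_comp mh (@measurable_fst _ _ _ _)).
  exact: (measurableT_comp (measurable_indic m01) (@measurable_snd _ _ _ _)).
apply/integrableP; split; first exact/measurable_EFinP.
have F0 p : 0 <= h p.1 * \1_(`[0, 1[%classic : set R) p.2.
  by rewrite mulr_ge0.
under eq_integral do rewrite /= ger0_norm //.
rewrite fubini_tonelli1 /=; last 2 first.
- exact/measurable_EFinP.
- by move=> p; rewrite lee_fin.
rewrite /fubini_F /=.
have -> : (\int[mu]_x \int[leb]_y (h x * \1_(`[0, 1[%classic : set R) y)%:E =
   \int[mu]_x `|(h x)%:E|)%E.
  apply: eq_integral => w _.
  under eq_integral do rewrite EFinM.
  rewrite ge0_integralZl ?lee_fin //; last first.
  - exact/measurable_EFinP/measurable_indic.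
  rewrite integral_indic // setIT.
  have l1 : leb (`[0, 1[%classic : set R) = 1%E.
    by rewrite lebesgue_measure_itv /= lte_fin ltr01 -EFinB subr0.
  transitivity ((h w)%:E * 1)%E; first by congr (_ * _)%E; exact: l1.
  by rewrite mule1 /= ger0_norm.
by have /integrableP[] := hi.
Qed.

Lemma iter_skew k w t : 0 <= t < 1 ->
  [/\ (iter k skew (w, t)).1 = iter k tau w,
      0 <= (iter k skew (w, t)).2 < 1 &
      circle (iter k skew (w, t)).2 = circle (angle w) ^+ k * circle t].
Proof.
move=> t01; elim: k => [|k [IH1 IH2 IH3]] /=; first by rewrite mul1r.
have ak : angle (iter k tau w) = angle w.
  by elim: (k) => //= n; rewrite angle_inv.
rewrite IH1 ak; split=> //; first exact: rotation_unit.
by rewrite circle_rotation // IH3 exprS mulrA.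
Qed.

(** Birkhoff's theorem for the skew product applies to the real and imaginary
    parts of e(t) g(w). A single good t for a given w suffices, since e(t)
    factors out of the averages. *)
Theorem birkhoff_random_frequency (g : T -> R[i]) : cmeasurable g ->
  mu.-integrable setT (EFin \o (fun w => cabs (g w))) ->
  {ae mu, forall w, cvgn (exponential_average (fun k => g (iter k tau w))
     (circle (angle w)) : nat -> R[i]^o)}.
Proof.
move=> [mRe mIm] gi.
pose unit_itv : set (measurableTypeR R) := `[0, 1[%classic.
pose G1 (p : TR) : R := complex.Re (circle p.2 * g p.1) * \1_unit_itv p.2.
pose G2 (p : TR) : R := complex.Im (circle p.2 * g p.1) * \1_unit_itv p.2.
have m01 : measurable unit_itv by exact: measurable_itv.
have mh (h : R -> R) : continuous h ->
    measurable_fun setT (fun p : TR => h (pi *+ 2 * p.2)).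
  move=> ch; apply: (measurableT_comp (continuous_measurable_fun ch)).
  apply: (measurableT_comp (mulrl_measurable (pi *+ 2))).
  exact: (@measurable_snd _ _ T (measurableTypeR R)).
have mc : measurable_fun setT (fun p : TR => complex.Re (circle p.2)).
  exact: mh (@continuous_cos R).
have ms : measurable_fun setT (fun p : TR => complex.Im (circle p.2)).
  exact: mh (@continuous_sin R).
have m1 : measurable_fun setT (fun p : TR => \1_unit_itv p.2 : R).
  exact: (measurableT_comp (measurable_indic m01) (@measurable_snd _ _ _ _)).
have mR : measurable_fun setT (fun p : TR => complex.Re (g p.1)).
  exact: (measurableT_comp mRe (@measurable_fst _ _ _ _)).
have mI : measurable_fun setT (fun p : TR => complex.Im (g p.1)).
  exact: (measurableT_comp mIm (@measurable_fst _ _ _ _)).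
have dom := integrable_skew_cutoff gi (fun w => cabs_ge0 (g w)).
have iG1 : (mu \x leb)%E.-integrable setT (EFin \o G1).
  apply: (integrable_dominated _ dom).
    apply: measurable_funM => //.
    rewrite (_ : (fun p : TR => complex.Re (circle p.2 * g p.1)) = fun p =>
      complex.Re (circle p.2) * complex.Re (g p.1) -
      complex.Im (circle p.2) * complex.Im (g p.1)); last first.
      by apply/funext => p; rewrite /=; case: (g p.1).
    by apply: measurable_funB; exact: measurable_funM.
  move=> p; rewrite /G1 normrM [X in _ * X]ger0_norm //.
  apply: ler_wpM2r => //; apply: le_trans (Re_le_cabs _) _.
  by rewrite cabsM cabs_circle mul1r.
have iG2 : (mu \x leb)%E.-integrable setT (EFin \o G2).
  apply: (integrable_dominated _ dom).
    apply: measurable_funM => //.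
    rewrite (_ : (fun p : TR => complex.Im (circle p.2 * g p.1)) = fun p =>
      complex.Re (circle p.2) * complex.Im (g p.1) +
      complex.Im (circle p.2) * complex.Re (g p.1)); last first.
      by apply/funext => p; rewrite /=; case: (g p.1).
    by apply: measurable_funD; exact: measurable_funM.
  move=> p; rewrite /G2 normrM [X in _ * X]ger0_norm //.
  apply: ler_wpM2r => //; apply: le_trans (Im_le_cabs _) _.
  by rewrite cabsM cabs_circle mul1r.
have [N [mN N0 sN]] := filterI (birkhoff skew_measure_preserving iG1)
                               (birkhoff skew_measure_preserving iG2).
have aeN : {ae mu, forall w, leb (xsection N w) = 0%E}.
  have mx := measurable_fun_xsection leb mN.
  have /(ae_eq_integral_abs mu measurableT mx) : (\int[mu]_w `|leb (xsection N w)| = 0)%E.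
    by rewrite -[RHS]N0; apply: eq_integral => w _; rewrite gee0_abs.
  by apply: filterS => w /(_ I).
apply: filterS aeN => w Nw.
have [t t01 nNt] : exists2 t, 0 <= t < 1 & ~ N (w, t).
  apply: contrapT => nex.
  have : (leb unit_itv <= leb (xsection N w))%E.
    apply: le_measure; rewrite ?inE //; first exact: measurable_xsection.
    move=> t; rewrite /unit_itv /= in_itv /= => t01; rewrite /xsection /= inE.
    by apply: contrapT => nN; apply: nex; exists t.
  by rewrite Nw lebesgue_measure_itv /= lte_fin ltr01 -EFinB subr0 lee_fin ler10.
have [c1 c2] : cvgn (fun n => n%:R^-1 * birkhoff_sum skew G1 n (w, t)) /\
    cvgn (fun n => n%:R^-1 * birkhoff_sum skew G2 n (w, t)).
  by apply: contrapT => h; apply: nNt; apply: sN.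
pose u := exponential_average (fun k => g (iter k tau w)) (circle (angle w)).
have in1 k : \1_unit_itv (iter k skew (w, t)).2 = 1 :> R.
  have [_ h _] := iter_skew k w t01.
  by rewrite indicE mem_set //= in_itv.
have term k : circle (iter k skew (w, t)).2 * g (iter k skew (w, t)).1 =
    circle t * (circle (angle w) ^+ k * g (iter k tau w)).
  by have [-> _ ->] := iter_skew k w t01; rewrite mulrCA mulrA.
have e1 n : n%:R^-1 * birkhoff_sum skew G1 n (w, t) = complex.Re (circle t * u n).
  rewrite /u /exponential_average mulrCA natV_complex Re_scale; congr (_ * _).
  rewrite mulr_sumr Re_sum; apply: eq_bigr => k _.
  by rewrite /G1 in1 mulr1 term.
have e2 n : n%:R^-1 * birkhoff_sum skew G2 n (w, t) = complex.Im (circle t * u n).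
  rewrite /u /exponential_average mulrCA natV_complex Im_scale; congr (_ * _).
  rewrite mulr_sumr Im_sum; apply: eq_bigr => k _.
  by rewrite /G2 in1 mulr1 term.
have cu : cvgn ((fun n => circle t * u n) : nat -> R[i]^o).
  apply: cvgn_complex.
    by under eq_fun do rewrite -e1.
  by under eq_fun do rewrite -e2.
apply: cauchy_cvgn_complex => e e0.
have [n0 hn0] := cvgn_complex_cauchy cu e0; exists n0 => m n h1 h2.
by have := hn0 m n h1 h2; rewrite -mulrBr cabsM cabs_circle mul1r.
Qed.

End skew_product.

(** * The Wiener-Wintner theorem for bounded integrable functions *)

Section complex_measurability.
Context (R : realType) (d : measure_display) (T : measurableType d).
Implicit Types f g : T -> R[i].

Lemma cmeasurable_cabs f : cmeasurable f ->
  measurable_fun setT (fun x => cabs (f x)).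
Proof.
move=> [mr mi]; under eq_fun do rewrite cabs_sqrt.
apply: (measurableT_comp (continuous_measurable_fun (@sqrt_continuous R))).
by apply: measurable_funD; exact: measurable_funX.
Qed.

Lemma cmeasurableZ (c : R[i]) f : cmeasurable f -> cmeasurable (fun x => c * f x).
Proof.
case: c => a b [mr mi]; split.
  rewrite (_ : (fun x => _) = fun x => a * complex.Re (f x) - b * complex.Im (f x)).
    by apply: measurable_funB; exact: measurable_funM.
  by apply/funext => x; case: (f x).
rewrite (_ : (fun x => _) = fun x => a * complex.Im (f x) + b * complex.Re (f x)).
  by apply: measurable_funD; exact: measurable_funM.
by apply/funext => x; case: (f x).
Qed.

Lemma cmeasurable_sum n (F : nat -> T -> R[i]) :
  (forall k, cmeasurable (F k)) -> cmeasurable (fun x => \sum_(k < n) F k x).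
Proof.
move=> mF; split.
  under eq_fun do rewrite Re_sum.
  by apply: measurable_sum => k; exact: (mF k).1.
under eq_fun do rewrite Im_sum.
by apply: measurable_sum => k; exact: (mF k).2.
Qed.

Lemma cmeasurable_comp f (s : T -> T) : measurable_fun setT s ->
  cmeasurable f -> cmeasurable (f \o s).
Proof.
move=> ms [mr mi]; split; [exact: (measurableT_comp mr ms)|].
exact: (measurableT_comp mi ms).
Qed.

Lemma bigcup_rat_measurable (F : rat -> set T) (P : set rat) :
  (forall q, P q -> measurable (F q)) -> measurable (\bigcup_(q in P) F q).
Proof.
move=> PF; rewrite bigcup_mkcond; apply: bigcupT_measurable_rat => q.
by case: ifP => //; rewrite inE; exact: PF.
Qed.

End complex_measurability.

Section wiener_wintner.
Context (R : realType) (d : measure_display) (T : measurableType d).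
Variables (mu : {sigma_finite_measure set T -> \bar R}) (tau : T -> T).
Hypothesis htau : measure_preserving mu tau.
Variables (g : T -> R[i]) (M : R).
Hypothesis mg : cmeasurable g.
Hypothesis gM : forall w, cabs (g w) <= M.
Hypothesis gi : mu.-integrable setT (EFin \o (fun w => cabs (g w))).

Definition orbit_values w k : R[i] := g (iter k tau w).

Let aM w k : cabs (orbit_values w k) <= M. Proof. exact: gM. Qed.

Let measurable_window H z k :
  measurable_fun setT (fun w => window (orbit_values w) H z k).
Proof.
apply: cmeasurable_cabs; apply: cmeasurableZ.
apply: (@cmeasurable_sum _ _ _ H (fun h w => orbit_values w (k + h) * z ^+ h)) => h.
under eq_fun do rewrite mulrC.
by apply/cmeasurableZ/(cmeasurable_comp _ mg); exact: (measurable_iter_tau htau).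
Qed.

Let measurable_window_mean H z n :
  measurable_fun setT (fun w => window_mean (orbit_values w) H z n).
Proof.
apply: measurable_funM => //.
by apply: measurable_sum => k; exact: measurable_window.
Qed.

(** The window moduli are the values of one integrable function along the
    orbit. *)
Lemma window_mean_ae_cvg H z : cabs z = 1 ->
  {ae mu, forall w, cvgn (window_mean (orbit_values w) H z)}.
Proof.
move=> z1; pose phi w := window (orbit_values w) H z 0.
have iphi : mu.-integrable setT (EFin \o phi).
  pose S := fun w => birkhoff_sum tau (fun w => cabs (g w)) H w.
  have iS : mu.-integrable setT (EFin \o S) by exact: integrable_birkhoff_sum.
  have iS' : mu.-integrable setT (EFin \o (fun w => H%:R^-1 * S w)).
    exact: (integrableZl measurableT _ iS).
  apply: (integrable_dominated (measurable_window H z 0) iS') => w.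
  rewrite ger0_norm ?cabs_ge0 // /phi /window cabsM cabs_natV.
  apply: ler_wpM2l; first by rewrite invr_ge0.
  apply: le_trans (cabs_sum _ _ _) _; apply: ler_sum => h _.
  by rewrite cabsM cabsX z1 expr1n mulr1.
apply: filterS (birkhoff htau iphi) => w.
rewrite (_ : (fun n => _) = window_mean (orbit_values w) H z) //.
apply/funext => n; rewrite /birkhoff_sum /window_mean; congr (_ * _).
apply: eq_bigr => k _; rewrite /phi /window; congr (cabs (_ * _)).
by apply: eq_bigr => h _; rewrite /orbit_values add0n addnC iterD.
Qed.

Lemma window_mean_ae_cvg_all :
  {ae mu, forall w, forall H t, cvgn (window_mean (orbit_values w) H (circle t))}.
Proof.
pose F (k : nat) w : Prop :=
  let: (H, q) := odflt (0%N, 0 : rat) (unpickle k) in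
  cvgn (window_mean (orbit_values w) H (circle (ratr q))).
have aeF k : {ae mu, forall w, F k w}.
  rewrite /F; case: (odflt _ _) => H q; exact/window_mean_ae_cvg/cabs_circle.
apply: filterS (ae_foralln aeF) => w Fw H t.
have M0 : 0 <= M by exact: le_trans (cabs_ge0 _) (gM w).
apply: (@window_mean_cvg _ (orbit_values w) M H t M0 (aM w)) => q.
by have := Fw (pickle (H, q)); rewrite /F pickleK.
Qed.

(** Adding 1, the end of the circle, keeps the infimum over a nonempty set. *)
Definition least_persistent (s eps : R) (w : T) : R :=
  inf ([set u | s <= u <= 1 /\ persistent (orbit_values w) eps (circle u)]
       `|` [set 1]).

Lemma least_persistent_has_inf (s eps : R) w :
  has_inf ([set u | s <= u <= 1 /\ persistent (orbit_values w) eps (circle u)]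
       `|` [set 1]).
Proof.
split; first by exists 1; right.
by exists (Num.min s 1) => u [[/andP[su _] _]| ->]; rewrite ge_min ?su ?lexx ?orbT.
Qed.

Lemma least_persistent01 (s eps : R) w : 0 <= s ->
  0 <= least_persistent s eps w <= 1.
Proof.
move=> s0; apply/andP; split.
  apply: lb_le_inf; first by exists 1; right.
  by move=> u [[/andP[su _] _]| ->] //; exact: le_trans su.
by apply: ge_inf; [exact: (least_persistent_has_inf s eps w).2|right].
Qed.

Lemma least_persistent_inv (s eps : R) w :
  least_persistent s eps (tau w) = least_persistent s eps w.
Proof.
have M0 : 0 <= M by exact: le_trans (cabs_ge0 _) (gM w).
rewrite /least_persistent; congr (inf (_ `|` _)).
have e u := persistent_shift eps M0 (aM w) (cabs_circle u).
have -> : orbit_values (tau w) = fun k => orbit_values w k.+1.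
  by apply/funext => k; rewrite /orbit_values iterSr.
by apply/seteqP; split=> u [? /e].
Qed.

Lemma measurable_least_persistent (s eps : R) :
  measurable_fun setT (least_persistent s eps).
Proof.
apply: (measurability _ (RGenInftyO.measurableE R)) => //.
move=> _ [_ [x ->] <-]; rewrite setTI.
have [x1|x1] := ltP 1 x.
  rewrite (_ : _ @^-1` _ = setT) //; apply/seteqP; split=> // w _ /=.
  rewrite in_itv /=; apply: le_lt_trans x1.
  by apply: ge_inf; [exact: (least_persistent_has_inf s eps w).2|right].
pose A (c : rat) := \bigcap_j \bigcup_(q in [set q : rat | s <= (ratr q : R) <= ratr c])
  \bigcap_(H in [set H | (0 < H <= j)%N]) \bigcup_n0 \bigcap_(n in [set n | (n0 <= n)%N])
  [set w | eps - j.+1%:R^-1 <= window_mean (orbit_values w) H (circle (ratr q)) n].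
have mA c : measurable (A c).
  apply: bigcap_measurableType => // j _; apply: bigcup_rat_measurable => q _.
  apply: bigcap_measurableType => H _; apply: bigcup_measurable => n0 _.
  apply: bigcap_measurableType => n _; rewrite -[X in measurable X]setTI.
  exact: (measurable_fun_ler (measurable_cst _) (measurable_window_mean H _ n)
    measurableT (Y := [set true])).
have M0 (w : T) : 0 <= M by exact: le_trans (cabs_ge0 _) (gM w).
have AP c w : A c w <->
    exists2 t : R, s <= t <= ratr c & persistent (orbit_values w) eps (circle t).
  apply: (iff_trans _ (iff_sym (persistent_arcP eps s c (M0 w) (aM w)))).
  split=> [h j|h j _]; first by have [q sqc hq] := h j I; exists q.
  by have [q sqc hq] := h j; exists q.
rewrite (_ : _ @^-1` _ = \bigcup_(c in [set c : rat | (ratr c : R) < x]) A c).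
  by apply: bigcup_rat_measurable => c _; exact: mA.
apply/seteqP; split=> w /=; rewrite in_itv /=.
  move=> /(inf_lt (least_persistent_has_inf s eps w).1) [u].
  case=> [[/andP[su u1] pu] ux|-> ux]; last by rewrite ltNge x1 in ux.
  have [c] := rat_in_itvoo ux; rewrite in_itv /= => /andP[uc cx].
  by exists c => //; apply/AP; exists u => //; rewrite su ltW.
move=> [c cx /AP[u /andP[su uc] pu]].
apply: (le_lt_trans _ cx); apply: (le_trans _ uc).
apply: ge_inf; first exact: (least_persistent_has_inf s eps w).2.
left; split=> //; rewrite su /=; apply: le_trans x1; apply: ltW.
exact: (le_lt_trans uc cx).
Qed.

(** At a given w, a frequency that is not persistent at any level contributes
    averages tending to 0. A persistent one is isolated from the left, hence
    equal to [least_persistent s eps w] for a rational s; the countably many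
    invariant choices of this form are handled by
    [birkhoff_random_frequency]. *)
Theorem wiener_wintner_bounded :
  {ae mu, forall w, forall z, `|z| = 1 ->
    cvgn (exponential_average (orbit_values w) z : nat -> R[i]^o)}.
Proof.
pose eps j : R := j.+1%:R^-1.
have eps0 j : 0 < eps j by rewrite invr_gt0.
pose F (k : nat) w : Prop :=
  let: (s, j) := odflt (0 : rat, 0%N) (unpickle k) in
  cvgn (exponential_average (orbit_values w)
    (circle (least_persistent (Num.max 0 (ratr s)) (eps j) w)) : nat -> R[i]^o).
have aeF k : {ae mu, forall w, F k w}.
  rewrite /F; case: (odflt _ _) => s j.
  apply: (birkhoff_random_frequency htau _ _ _ mg gi).
  - exact: measurable_least_persistent.
  - by move=> w; apply: least_persistent01; rewrite le_max lexx.
  - exact: least_persistent_inv.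
apply: filterS2 (ae_foralln aeF) window_mean_ae_cvg_all => w Fw cw z z1.
have M0 : 0 <= M by exact: le_trans (cabs_ge0 _) (gM w).
have [t t01 tz] := circle_surj z1; rewrite -tz.
have [[j pt]|np] := pselect (exists j, persistent (orbit_values w) (eps j) (circle t)).
  have [s st iso] := persistent_isolated (eps0 j) M0 (aM w) t01.
  have -> : t = least_persistent (Num.max 0 (ratr s)) (eps j) w.
    have /andP[t0 t1] := t01.
    apply/le_anti/andP; split; last first.
      apply: ge_inf; first exact: (least_persistent_has_inf _ _ w).2.
      by left; split=> //; rewrite st ltW.
    apply: lb_le_inf; first by exists 1; right.
    move=> u [[/andP[su u1] pu]| ->]; last exact: ltW.
    by rewrite leNgt; apply/negP => ut; apply: (iso u) => //; rewrite su.
  by have := Fw (pickle (s, j)); rewrite /F pickleK.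
apply: cauchy_cvgn_complex => e e0.
pose j := Num.truncn (4 / e).
have je : 4 * eps j <= e.
  rewrite /eps ler_pdivrMr ?ltr0Sn // mulrC -ler_pdivrMr //.
  exact/ltW/truncnS_gt.
have nj : ~ persistent (orbit_values w) (eps j) (circle t).
  by move=> h; apply: np; exists j.
have [n0 _ hn] := not_persistent_small (eps0 j) (aM w) (cabs_circle t)
  (fun H => cw H t) nj.
exists n0 => m n h1 h2; apply: le_trans (cabsD _ _) _; rewrite cabsN.
by have := hn m h1; have := hn n h2; lra.
Qed.

End wiener_wintner.

(** * Rearrangements and fully symmetric spaces without constants *)

Section rearrangement.
Context (R : realType) (d : measure_display) (T : measurableType d).
Variable mu : {measure set T -> \bar R}.
Implicit Types (f : T -> R[i]) (lam t : R).

Local Notation levels f t :=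
  [set lam : R | 0 < lam /\ (mu (superlevel f lam) <= t%:E)%E].

Lemma measurable_superlevel f lam : cmeasurable f ->
  measurable (superlevel f lam).
Proof. by move=> mf; apply: measurable_gt; exact: cmeasurable_cabs. Qed.

Lemma levels_lbound f t : has_lbound (levels f t).
Proof. by exists 0 => lam [/ltW]. Qed.

Lemma superlevel_le f lam lam' : cmeasurable f -> lam <= lam' ->
  (mu (superlevel f lam') <= mu (superlevel f lam))%E.
Proof.
move=> mf ll; apply: le_measure; rewrite ?inE; try exact: measurable_superlevel.
by move=> x; exact: le_lt_trans.
Qed.

Lemma rearr_ge0 f t : 0 <= rearr mu f t.
Proof.
rewrite /rearr; have [->|/set0P ne] := eqVneq (levels f t) set0.
  by rewrite inf0.
by apply: lb_le_inf => // lam [/ltW].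
Qed.

Lemma rearr_neg f t : t < 0 -> rearr mu f t = 0.
Proof.
move=> t0; rewrite /rearr (_ : levels f t = set0) ?inf0 //.
apply/seteqP; split=> // lam [_]; apply/negP; rewrite -ltNge.
by apply: lt_le_trans (measure_ge0 _ _); rewrite lte_fin.
Qed.

Lemma levels_nonempty f t : L0mu mu f -> 0 < t -> levels f t !=set0.
Proof.
move=> [mf [l l0 lfin]] t0.
have cv : mu (superlevel f (l + n%:R)) @[n --> \oo] --> mu (\bigcap_n superlevel f (l + n%:R)).
  apply: nonincreasing_cvg_mu.
  - by rewrite addr0.
  - by move=> n; exact: measurable_superlevel.
  - by apply: bigcapT_measurable => n; exact: measurable_superlevel.
  - move=> m n mn; apply/subsetPset => x; apply: le_lt_trans.
    by rewrite lerD2l ler_nat.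
have I0 : \bigcap_n superlevel f (l + n%:R) = set0.
  apply/seteqP; split=> // x /(_ (Num.truncn (cabs (f x))).+1 I).
  rewrite /superlevel /=; have := truncnS_gt (cabs (f x)); lra.
rewrite I0 measure0 in cv.
have [n0 _ hn] : \forall n \near \oo, (mu (superlevel f (l + n%:R)) < t%:E)%E.
  have h : ereal_nbhs (0%E : \bar R) (fun u => (u < t%:E)%E).
    by apply: open_ereal_lt'; rewrite lte_fin.
  exact: (cv _ h).
exists (l + n0%:R); split; first by rewrite ltr_pwDl.
by apply: ltW; apply: hn => /=.
Qed.

(** The rearrangement and the distribution function are generalized inverses of
    one another; the direct implication uses the right continuity of the
    distribution function. *)
Lemma rearr_le f lam t : L0mu mu f -> 0 < t -> 0 < lam ->
  rearr mu f t <= lam <-> (mu (superlevel f lam) <= t%:E)%E.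
Proof.
move=> f0 t0 l0; split=> [h|h]; last by apply: ge_inf => //; exact: levels_lbound.
have mf := proj1 f0.
have ne := levels_nonempty f0 t0.
have cv : mu (superlevel f (lam + n.+1%:R^-1)) @[n --> \oo] -->
    mu (\bigcup_n superlevel f (lam + n.+1%:R^-1)).
  apply: nondecreasing_cvg_mu.
  - by move=> n; exact: measurable_superlevel.
  - by apply: bigcupT_measurable => n; exact: measurable_superlevel.
  - move=> m n mn; apply/subsetPset => x; apply: le_lt_trans.
    by rewrite lerD2l lef_pV2 ?posrE ?ltr0n // ler_nat ltnS.
have -> : superlevel f lam = \bigcup_n superlevel f (lam + n.+1%:R^-1).
  apply/seteqP; split=> x.
    rewrite /superlevel /= => lx.
    have xl : 0 < cabs (f x) - lam by rewrite subr_gt0.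
    exists (Num.truncn ((cabs (f x) - lam)^-1)) => //=.
    rewrite -ltrBrDl -[ltRHS]invrK ltf_pV2 ?posrE ?ltr0n ?invr_gt0 //.
    exact: truncnS_gt.
  by move=> [n _]; rewrite /superlevel /=; apply: le_lt_trans; rewrite lerDl.
rewrite -(cvg_lim _ cv) //; apply: lime_le; first by apply/cvg_ex; eexists; exact: cv.
apply: nearW => n.
have /(inf_lt ne) [l [l1 l2] ll] : inf (levels f t) < lam + n.+1%:R^-1.
  by apply: le_lt_trans h _; rewrite ltrDl.
by apply: le_trans l2; exact: superlevel_le (ltW ll).
Qed.

Lemma rearr_noninc f s t : L0mu mu f -> 0 < s -> s <= t ->
  rearr mu f t <= rearr mu f s.
Proof.
move=> f0 s0 st; apply: lb_le_inf; first exact: levels_nonempty.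
move=> lam [l0 l1]; apply: ge_inf; first exact: levels_lbound.
by split=> //; apply: le_trans l1 _; rewrite lee_fin.
Qed.

Lemma measurable_rearr f : L0mu mu f ->
  measurable_fun setT (rearr mu f : measurableTypeR R -> R).
Proof.
move=> f0; apply: (measurability _ (RGenInftyO.measurableE R)) => //.
move=> _ [_ [x ->] <-]; rewrite setTI; set A := _ @^-1` _.
have -> : A = (A `&` `]-oo, 0[) `|` (A `&` [set 0]) `|` (A `&` `]0, +oo[).
  apply/seteqP; split=> t; last by move=> [[[]|[]]|[]].
  move=> At; have [t0|t0|t0] := ltgtP t 0.
  - by left; left; split=> //=; rewrite in_itv.
  - by right; split=> //=; rewrite in_itv /= t0.
  - by left; right.
apply: measurableU; first apply: measurableU; apply: is_interval_measurable.
- move=> a b [Aa]; rewrite /= !in_itv /= => a0 [Ab b0] u /andP[au ub].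
  have u0 : u < 0 by exact: le_lt_trans ub b0.
  split; last by rewrite /= in_itv.
  by move: Aa; rewrite /A /= !in_itv /= (rearr_neg _ u0) (rearr_neg f).
- move=> a b [Aa a0] [Ab b0] u; rewrite b0 => /andP[u0 u1].
  by have -> : u = a by apply/le_anti; rewrite u0 a0 u1.
- move=> a b [Aa]; rewrite /= !in_itv /= !andbT => a0 [Ab b0] u /andP[au ub].
  split; last by rewrite /= in_itv /= andbT (lt_le_trans a0 au).
  move: Aa; rewrite /A /= !in_itv /=; apply: le_lt_trans.
  exact: rearr_noninc.
Qed.

End rearrangement.

Section staircase.
Context (R : realType).
Variable c : R.
Hypothesis c0 : 0 < c.

(** Partial sums of a step function that is comparable with x above the level c.
    The integral of that step function along a function is a sum of measures of
    level sets, hence the same for equimeasurable functions. *)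
Definition staircase (n : nat) (x : R) : R :=
  \sum_(k < n) c * (k.+1%:R * c < x)%R%:R.

Lemma staircaseS n x :
  staircase n.+1 x = staircase n x + c * (n.+1%:R * c < x)%R%:R.
Proof. by rewrite /staircase big_ord_recr. Qed.

Lemma staircase_le n x : 0 <= x -> staircase n x <= x.
Proof.
move=> x0; elim: n => [|n IH]; first by rewrite /staircase big_ord0.
rewrite staircaseS; case: ltP => [nx|_]; last by rewrite mulr0 addr0.
apply: le_trans (ltW nx); rewrite mulr1 -natr1 mulrDl mul1r lerD2r.
rewrite /staircase mulr_natl -[n in leRHS]card_ord -sumr_const.
by apply: ler_sum => k _; apply: ler_piMr; [exact: ltW|rewrite lern1 leq_b1].
Qed.

Lemma staircase_ge n x : Num.min (x - c) (n%:R * c) <= staircase n x.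
Proof.
elim: n => [|n IH].
  by rewrite /staircase big_ord0 mul0r ge_min lexx orbT.
rewrite staircaseS ge_min; move: IH; rewrite ge_min.
have e : n.+1%:R * c = n%:R * c + c by rewrite -natr1 mulrDl mul1r.
case: ltP => h; rewrite ?mulr1 ?mulr0 => /orP[] h'; apply/orP; rewrite ?e in h *.
- by right; lra.
- by right; lra.
- by left; lra.
- by left; lra.
Qed.

Lemma staircase_double x : c < x -> exists n, x <= 2 * staircase n x.
Proof.
move=> cx; pose n := (Num.truncn (x / c)).+1; exists n.
have xn : x < n%:R * c by rewrite -ltr_pdivrMr //; exact: truncnS_gt.
have := staircase_ge n x; rewrite ge_min => /orP h.
have xs : x - c <= staircase n x.
  case: h => // h.
  by apply: le_trans h; apply: ltW; apply: le_lt_trans xn; rewrite gerBl ltW.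
have : c <= staircase n x.
  rewrite /staircase /n big_ord_recl /= mul1r cx mulr1 lerDl.
  by apply: sumr_ge0 => k _; rewrite mulr_ge0 // ltW.
by lra.
Qed.

Definition full_staircase (x : R) : \bar R :=
  (\sum_(k <oo) (c * (k.+1%:R * c < x)%R%:R)%:E)%E.

Let step_ge0 x (k : nat) : (0 <= (c * (k.+1%:R * c < x)%R%:R)%:E)%E.
Proof. by rewrite lee_fin mulr_ge0 // ltW. Qed.

Lemma full_staircase_ge0 x : (0 <= full_staircase x)%E.
Proof. by apply: nneseries_ge0 => k _ _; exact: step_ge0. Qed.

Lemma partial_staircase n x :
  (\sum_(0 <= k < n) (c * (k.+1%:R * c < x)%R%:R)%:E)%E = (staircase n x)%:E.
Proof. by rewrite big_mkord sumEFin. Qed.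

Lemma full_staircase_le x : 0 <= x -> (full_staircase x <= x%:E)%E.
Proof.
move=> x0; apply: lime_le; first by apply: is_cvg_nneseries => k _ _; exact: step_ge0.
by apply: nearW => n; rewrite partial_staircase lee_fin staircase_le.
Qed.

Lemma full_staircase_double x : c < x -> (x%:E <= 2%:E * full_staircase x)%E.
Proof.
move=> /staircase_double[n xn].
apply: (@le_trans _ _ (2%:E * (staircase n x)%:E)%E); first by rewrite -EFinM lee_fin.
apply: lee_wpmul2l => //; rewrite -partial_staircase.
by apply: nneseries_lim_ge => k _ _; exact: step_ge0.
Qed.

Context (d : measure_display) (T : measurableType d).
Variable mu : {measure set T -> \bar R}.

Let step_indic (g : T -> R) k x : (c * (k.+1%:R * c < g x)%R%:R)%:E =
   (c%:E * (\1_[set x | (k.+1%:R * c < g x)%R] x)%:E)%E.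
Proof.
by rewrite -EFinM indicE; congr (_ * _%:R)%:E; congr nat_of_bool;
  apply/idP/idP; rewrite inE.
Qed.

Let measurable_step (g : T -> R) (D : set T) k : measurable_fun setT g ->
  measurable_fun D (fun x => (c * (k.+1%:R * c < g x)%R%:R)%:E).
Proof.
move=> mg; under eq_fun do rewrite step_indic.
apply: measurable_funeM; apply/measurable_EFinP; apply: measurable_indic.
exact: measurable_gt.
Qed.

Lemma measurable_full_staircase (g : T -> R) : measurable_fun setT g ->
  measurable_fun setT (fun x => full_staircase (g x)).
Proof.
move=> mg; apply: (emeasurable_fun_cvg
  (fun n x => (\sum_(0 <= k < n) (c * (k.+1%:R * c < g x)%R%:R)%:E)%E)).
  by move=> n; apply: emeasurable_sum => k; exact: measurable_step.
by move=> x _; apply: is_cvg_nneseries => k _ _; exact: step_ge0.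
Qed.

(** Layer-cake formula for the staircase of g: its integral depends only on the
    measures of the level sets of g. *)
Lemma integral_full_staircase (D : set T) (g : T -> R) : measurable D ->
  measurable_fun setT g ->
  (\int[mu]_(x in D) full_staircase (g x) =
   \sum_(k <oo) (c%:E * mu (D `&` [set x | (k.+1%:R * c < g x)%R])))%E.
Proof.
move=> mD mg.
rewrite integral_nneseries //; last by move=> k; exact: measurable_step.
apply: eq_eseriesr => k _; under eq_integral do rewrite step_indic.
have mk : measurable [set x | (k.+1%:R * c < g x)%R] by exact: measurable_gt.
rewrite ge0_integralZl_EFin //.
- by rewrite integral_indic // setIC.
- exact/measurable_EFinP/measurable_indic.
- exact: ltW.
Qed.

End staircase.

Section fully_symmetric_without_constants.
Context (R : realType) (d : measure_display) (T : measurableType d).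
Variable mu : {measure set T -> \bar R}.
Local Notation nu := (halfline R).
Local Notation star f := (fun t : measurableTypeR R => (rearr mu f t)%:C).

Lemma halfline_below (m : \bar R) : (0 <= m)%E ->
  nu [set t | (t%:E < m)%E] = m.
Proof.
move=> m0; rewrite /halfline /= /mrestr.
case: m m0 => [m| |] //; rewrite ?lee_fin => m0.
  rewrite (_ : _ `&` _ = `]0, m[%classic); last first.
    by apply/seteqP; split=> t /=; rewrite !in_itv /= lte_fin andbT;
       [move=> [-> ->]|move=> /andP[-> ->]].
  rewrite lebesgue_measure_itv /= lte_fin; case: ltP => h; first by rewrite -EFinB subr0.
  by congr EFin; apply/le_anti; rewrite m0 h.
rewrite (_ : _ `&` _ = `]0, +oo[%classic); last first.
  by apply/seteqP; split=> t /=; [case|move=> ?; split=> //; rewrite ltry].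
by rewrite lebesgue_measure_itv /= ltry.
Qed.

Lemma halfline_itv (s : R) : 0 < s -> nu `]0, s[%classic = s%:E.
Proof.
move=> s0; rewrite /halfline /= /mrestr.
rewrite (_ : _ `&` _ = `]0, s[%classic); last first.
  by apply/seteqP; split=> t /=; rewrite !in_itv /= ?andbT; [case|move=> /andP[-> ->]].
by rewrite lebesgue_measure_itv /= lte_fin s0 -EFinB subr0.
Qed.

Lemma rearr_distribution (f : T -> R[i]) (lam : R) : L0mu mu f -> 0 < lam ->
  nu (superlevel (star f) lam) = mu (superlevel f lam).
Proof.
move=> f0 l0; rewrite -[RHS]halfline_below // /halfline /= /mrestr.
congr (lebesgue_measure _); apply/seteqP; split=> t [+ t0];
  move: (t0); rewrite /= in_itv /= andbT => tpos h; split=> //.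
all: move: h; rewrite /superlevel /= cabsR ger0_norm ?rearr_ge0 //.
all: rewrite !ltNge; apply: contra => h.
- by apply/(rearr_le f0).
- by apply/(rearr_le f0).
Qed.

Lemma rearr_idem (f : T -> R[i]) : L0mu mu f ->
  rearr nu (star f) = rearr mu f.
Proof.
move=> f0; apply/funext => t; rewrite /rearr; congr inf.
apply/seteqP; split=> lam [l0 h]; split=> //.
  by rewrite -(rearr_distribution f0 l0).
by rewrite (rearr_distribution f0 l0).
Qed.

Lemma L0mu_one : L0mu mu (fun=> 1).
Proof.
split; first by split; exact: measurable_cst.
exists 1 => //; rewrite (_ : superlevel _ _ = set0) ?measure0 //.
by apply/seteqP; split=> // w; rewrite /superlevel /= cabsR normr1 ltxx.
Qed.

Lemma rearr_one_le t : rearr mu (fun=> 1) t <= 1.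
Proof.
have [t0|t0] := leP 0 t; last by rewrite rearr_neg.
apply: ge_inf; first exact: levels_lbound.
split=> //; rewrite (_ : superlevel _ _ = set0) ?measure0 ?lee_fin //.
by apply/seteqP; split=> // w; rewrite /superlevel /= cabsR normr1 ltxx.
Qed.

Variables (E : set (measurableTypeR R -> R[i])) (N : (measurableTypeR R -> R[i]) -> R).
Hypothesis hE : fully_symmetric E N.
Hypothesis h1 : ~ generated_space mu E (fun=> 1).

(** If the constants are not in E(Omega), the means of f^* over ]0, s[ get
    arbitrarily small: a positive lower bound c for them would make f^* dominate
    the rearrangement of the constant c. *)
Lemma rearr_mean_small (f : T -> R[i]) (c : R) : generated_space mu E f -> 0 < c ->
  exists2 s : R, 0 < s &
    (\int[nu]_(t in `]0%R, s[) (rearr mu f t)%:E < (c * s)%:E)%E.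
Proof.
move=> [f0 Ef] c0; apply: contrapT => nex; apply: h1; split; first exact: L0mu_one.
pose g := fun t : measurableTypeR R => (c * rearr mu (fun=> 1) t)%:C.
have g_le t : cabs (g t) <= c.
  rewrite cabsR ger0_norm; last exact: mulr_ge0 (ltW c0) (rearr_ge0 _ _ _).
  by apply: ler_piMr (ltW c0) _; exact: rearr_one_le.
have mg : cmeasurable g.
  split=> /=; last exact: measurable_cst.
  exact: (measurable_funM (measurable_cst c) (measurable_rearr L0mu_one)).
have g_level : superlevel g c = set0.
  by apply/seteqP; split=> // t; rewrite /superlevel /= ltNge g_le.
have g0 : L0mu nu g.
  by split=> //; exists c => //; rewrite g_level measure0.
have Eg : E g.
  apply: (fs_dominated hE Ef g0 _).1 => s s0.
  apply: (@le_trans _ _ (c * s)%:E); last first.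
    by rewrite rearr_idem // leNgt; apply/negP => h; apply: nex; exists s.
  rewrite EFinM -(halfline_itv s0) -integral_cst //.
  apply: ge0_le_integral => //.
  - by move=> t _; rewrite lee_fin rearr_ge0.
  - apply/measurable_EFinP; apply: measurable_funTS; exact: measurable_rearr.
  - move=> t; rewrite /= in_itv /= => /andP[t0 ts]; rewrite lee_fin.
    by apply/(rearr_le g0 t0 c0); rewrite g_level measure0 lee_fin ltW.
have sub := fs_subspace hE.
have := subspace_lin sub (c^-1)%:C Eg (subspace_0 sub).
congr (E _); apply/funext => t; rewrite addr0 /g -rmorphM /=; congr (_%:C).
by rewrite mulKf // gt_eqF.
Qed.

Lemma integrable_above (f : T -> R[i]) (c : R) : generated_space mu E f -> 0 < c ->
  mu.-integrable setT (EFin \o (fun w => cabs (f w) * \1_(superlevel f c) w)).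
Proof.
move=> fE c0; have [f0 Ef] := fE; have mf := proj1 f0.
have [s s0 fs] := rearr_mean_small fE c0.
have mr : measurable_fun setT (rearr mu f : measurableTypeR R -> R).
  exact: measurable_rearr.
have mf' := cmeasurable_cabs mf.
have mD : measurable (`]0, s[%classic : set (measurableTypeR R)).
  exact: measurable_itv.
have nu_s := halfline_itv s0.
have fc_s : (mu (superlevel f c) <= s%:E)%E.
  rewrite leNgt; apply/negP => sf; move: fs; apply/negP; rewrite -leNgt.
  rewrite EFinM -nu_s -integral_cst //.
  apply: ge0_le_integral => //.
  - by move=> t _; rewrite lee_fin ltW.
  - by apply/measurable_EFinP; exact: measurable_funTS.
  - move=> t; rewrite /= in_itv /= => /andP[t0 ts]; rewrite lee_fin ltW // ltNge.
    apply/negP => /(rearr_le f0 t0 c0) h; move: sf; apply/negP; rewrite -leNgt.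
    by apply: le_trans h _; rewrite lee_fin ltW.
have stair : (\int[mu]_w full_staircase c (cabs (f w)) < +oo)%E.
  rewrite (integral_full_staircase c0 mu measurableT mf').
  have -> : (\sum_(k <oo) (c%:E * mu (setT `&` [set w | (k.+1%:R * c < cabs (f w))%R])) =
     \sum_(k <oo) (c%:E * nu (`]0%R, s[ `&` [set t | (k.+1%:R * c < rearr mu f t)%R])))%E.
    apply: eq_eseriesr => k _; congr (_ * _)%E; rewrite setTI.
    have kc0 : 0 < k.+1%:R * c by rewrite mulr_gt0.
    have ckc : c <= k.+1%:R * c by rewrite ler_peMl ?ler1n // ltW.
    transitivity (nu (superlevel (star f) (k.+1%:R * c))).
      by rewrite rearr_distribution.
    rewrite /halfline /= /mrestr; congr (lebesgue_measure _).
    apply/seteqP; split=> t /=; rewrite !in_itv /= andbT; last first.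
      by move=> [[_ h] t0]; split=> //; rewrite /superlevel /= cabsR ger0_norm ?rearr_ge0.
    rewrite /superlevel /= cabsR ger0_norm ?rearr_ge0 // => -[h t0].
    split=> //; split=> //; rewrite t0 /= -lte_fin; apply: lt_le_trans fc_s.
    apply: lt_le_trans (superlevel_le mu mf ckc).
    rewrite ltNge; apply/negP => /(rearr_le f0 t0 kc0).
    by rewrite leNgt h.
  rewrite -(integral_full_staircase c0 nu mD mr).
  apply: (@le_lt_trans _ _ (\int[nu]_(t in `]0%R, s[) (rearr mu f t)%:E)%E).
    apply: ge0_le_integral => //.
    - by move=> t _; exact: full_staircase_ge0.
    - by apply: measurable_funTS; exact: measurable_full_staircase.
    - by apply: measurable_funTS; exact/measurable_EFinP.
    - by move=> t _; apply: full_staircase_le => //; exact: rearr_ge0.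
  exact: lt_trans fs (ltry _).
have mi : measurable_fun setT (fun w => cabs (f w) * \1_(superlevel f c) w).
  by apply: measurable_funM => //; exact/measurable_indic/measurable_superlevel.
apply/integrableP; split; first exact/measurable_EFinP.
apply: (@le_lt_trans _ _ (\int[mu]_w (2%:E * full_staircase c (cabs (f w))))%E).
  apply: ge0_le_integral => //.
  - exact/measurableT_comp/measurable_EFinP.
  - by apply: measurable_funeM; exact: measurable_full_staircase.
  - move=> w _; rewrite /= normrM !ger0_norm ?cabs_ge0 // indicE.
    have [fc|nfc] := pselect (superlevel f c w).
      by rewrite mem_set // mulr1; exact: full_staircase_double.
    by rewrite memNset // mulr0 mule_ge0 // full_staircase_ge0.
rewrite ge0_integralZl_EFin //.
- by rewrite lte_mul_pinfty.
- by move=> w _; exact: full_staircase_ge0.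
- exact: measurable_full_staircase.
Qed.

End fully_symmetric_without_constants.

(** * Besicovitch weights and truncation *)

Section besicovitch_weights.
Context (R : realType).
Implicit Types (a b beta : nat -> R[i]).

Definition complex_mean a n : R[i] := n%:R^-1 * \sum_(k < n) a k.

Lemma complex_mean_dist a b n :
  cabs (complex_mean a n - complex_mean b n) <=
  n%:R^-1 * \sum_(k < n) cabs (a k - b k).
Proof.
rewrite /complex_mean -mulrBr -sumrB cabsM cabs_natV.
by apply: ler_wpM2l; [rewrite invr_ge0|exact: cabs_sum].
Qed.

Lemma complex_mean_cvg_approx a :
  (forall e : R, 0 < e -> exists2 b, cvgn (complex_mean b : nat -> R[i]^o) &
     \forall n \near \oo, n%:R^-1 * \sum_(k < n) cabs (a k - b k) <= e) ->
  cvgn (complex_mean a : nat -> R[i]^o).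
Proof.
move=> ab; apply: cauchy_cvgn_complex => e e0.
have e3 : 0 < e / 3 by rewrite divr_gt0.
have [b cb [N _ hN]] := ab _ e3.
have [N' hN'] := cvgn_complex_cauchy cb e3.
exists (maxn N N') => m n; rewrite !geq_max => /andP[m1 m2] /andP[n1 n2].
have d k : (N <= k)%N -> cabs (complex_mean a k - complex_mean b k) <= e / 3.
  by move=> Nk; exact: le_trans (complex_mean_dist _ _ _) (hN k Nk).
apply: le_trans (cabs_dist_add _ _ (complex_mean b m)) _.
apply: (@le_trans _ _ (e / 3 + (e / 3 + e / 3))); last by lra.
apply: lerD; first exact: d.
apply: le_trans (cabs_dist_add _ _ (complex_mean b n)) _.
apply: lerD; first exact: hN'.
by rewrite cabs_distC; exact: d.
Qed.

Lemma complex_mean_trigonometric a (P : int -> R[i]) :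
  trigonometric_polynomial P ->
  (forall z, `|z| = 1 -> cvgn (exponential_average a z : nat -> R[i]^o)) ->
  cvgn (complex_mean (fun k => P k%:Z * a k) : nat -> R[i]^o).
Proof.
move=> [s [z [lam [lam1 PE]]]] ca.
rewrite (_ : complex_mean _ =
    fun n => \sum_(j < s) z j * exponential_average a (lam j) n); last first.
  apply/funext => n; rewrite /complex_mean /exponential_average.
  under eq_bigr do rewrite PE mulr_suml.
  rewrite exchange_big /= mulr_sumr; apply: eq_bigr => j _.
  rewrite mulrCA; congr (_ * _); rewrite mulr_sumr; apply: eq_bigr => k _.
  by rewrite mulrA.
have h j : cvgn (exponential_average a (lam j) : nat -> R[i]^o) by exact: ca.
apply: cauchy_cvgn_complex => e e0.
pose K := \sum_(j < s) cabs (z j).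
have K0 : 0 < K + 1 by rewrite ltr_pwDr // sumr_ge0 // => j _; exact: cabs_ge0.
have eK : 0 < e / (K + 1) by rewrite divr_gt0.
have [N hN] : exists N, forall j m n, (N <= m)%N -> (N <= n)%N ->
    cabs (exponential_average a (lam j) m - exponential_average a (lam j) n) <= e / (K + 1).
  have /boolp.choice[Nj hNj] := fun j => cvgn_complex_cauchy (h j) eK.
  exists (\max_j Nj j) => j m n mN nN; apply: hNj.
    exact: leq_trans (leq_bigmax j) mN.
  exact: leq_trans (leq_bigmax j) nN.
exists N => m n mN nN; rewrite -sumrB.
apply: le_trans (cabs_sum _ _ _) _.
apply: (@le_trans _ _ (K * (e / (K + 1)))).
  rewrite mulr_suml; apply: ler_sum => j _; rewrite -mulrBr cabsM.
  by apply: ler_wpM2l; [exact: cabs_ge0|exact: hN].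
by rewrite mulrCA ler_piMr ?ltW // ltr_pdivrMr // mul1r ltrDl.
Qed.

Lemma limn_esup_lt_near (u : nat -> \bar R) (x : \bar R) :
  (limn_esup u < x)%E -> \forall n \near \oo, (u n < x)%E.
Proof.
rewrite limn_esup_lim (cvg_lim _ (@cvg_esups_inf R u)) //.
move=> /ereal_inf_lt[_ [n _ <-] h]; exists n => // k nk.
by apply: le_lt_trans h; apply: ereal_sup_ubound; exists k.
Qed.

(** A Besicovitch weight is close to a trigonometric polynomial in the mean, and
    multiplying by the bounded sequence a keeps them close. *)
Lemma besicovitch_mean_cvg a beta (M : R) : 0 <= M ->
  (forall k, cabs (a k) <= M) ->
  (forall z, `|z| = 1 -> cvgn (exponential_average a z : nat -> R[i]^o)) ->
  bounded_Besicovitch beta ->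
  cvgn (complex_mean (fun k => beta k * a k) : nat -> R[i]^o).
Proof.
move=> M0 aM ca [_ bP]; apply: complex_mean_cvg_approx => e e0.
have M1 : 0 < M + 1 by rewrite ltr_pwDr.
have [P tP limP] := bP _ (divr_gt0 e0 M1).
exists (fun k => P k%:Z * a k); first exact: complex_mean_trigonometric.
apply: filterS (limn_esup_lt_near limP) => n; rewrite lte_fin => h.
apply: (@le_trans _ _ ((n%:R^-1 * \sum_(k < n) cabs (beta k - P k%:Z)) * M)).
  rewrite -mulrA; apply: ler_wpM2l; first by rewrite invr_ge0.
  rewrite mulr_suml; apply: ler_sum => k _; rewrite -mulrBl cabsM.
  by apply: ler_wpM2l; [exact: cabs_ge0|exact: aM].
apply: (@le_trans _ _ (e / (M + 1) * M)); first by rewrite ler_wpM2r // ltW.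
by rewrite mulrAC ler_pdivrMr // ler_pM2l // lerDl.
Qed.

Lemma bounded_weight_mean_cvg a beta (C : R) :
  (forall k, cabs (beta k) <= C) ->
  (forall e : R, 0 < e -> exists2 b,
     cvgn (complex_mean (fun k => beta k * b k) : nat -> R[i]^o) &
     \forall n \near \oo, n%:R^-1 * \sum_(k < n) cabs (a k - b k) <= e) ->
  cvgn (complex_mean (fun k => beta k * a k) : nat -> R[i]^o).
Proof.
move=> bC ab; apply: complex_mean_cvg_approx => e e0.
have C0 : 0 <= C by exact: le_trans (cabs_ge0 _) (bC 0%N).
have C1 : 0 < C + 1 by rewrite ltr_pwDr.
have [b cb hb] := ab _ (divr_gt0 e0 C1); exists (fun k => beta k * b k) => //.
apply: filterS hb => n hn.
apply: (@le_trans _ _ (C * (n%:R^-1 * \sum_(k < n) cabs (a k - b k)))).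
  rewrite mulrCA; apply: ler_wpM2l; first by rewrite invr_ge0.
  rewrite mulr_sumr; apply: ler_sum => k _; rewrite -mulrBr cabsM.
  by apply: ler_wpM2r; [exact: cabs_ge0|exact: bC].
apply: (@le_trans _ _ (C * (e / (C + 1)))); first exact: ler_wpM2l.
by rewrite mulrCA ler_piMr ?ltW // ltr_pdivrMr // mul1r ltrDl.
Qed.

End besicovitch_weights.

Section truncation.
Context (R : realType) (d : measure_display) (T : measurableType d).
Variables (mu : {measure set T -> \bar R}) (tau : T -> T).
Hypothesis htau : measure_preserving mu tau.
Variable f : T -> R[i].
Hypothesis mf : cmeasurable f.
Hypothesis fi : forall c : R, 0 < c ->
  mu.-integrable setT (EFin \o (fun w => cabs (f w) * \1_(superlevel f c) w)).

Definition tail (c : R) (w : T) : R := cabs (f w) * \1_(superlevel f c) w.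

Lemma tail_ge0 c w : 0 <= tail c w.
Proof. by rewrite mulr_ge0 ?cabs_ge0. Qed.

Lemma integral_tail_cvg0 :
  (fun m : nat => \int[mu]_w (tail m.+1%:R w)%:E)%E @ \oo --> 0%E.
Proof.
have [] := @dominated_convergence _ T R mu setT measurableT
    (fun m w => (tail m.+1%:R w)%:E) (cst 0%E) (EFin \o tail 1).
- move=> m; apply: measurable_int; exact: fi.
- exact: measurable_cst.
- apply: aeW => w _; apply: cvg_near_cst.
  exists (Num.truncn (cabs (f w))).+1 => // m /= mw.
  rewrite /tail indicE memNset ?mulr0 // /superlevel /=; apply/negP; rewrite -leNgt.
  by apply/ltW/(lt_le_trans (truncnS_gt _)); rewrite ler_nat ltnW.
- exact: fi.
- apply: aeW => w m _ /=; rewrite lee_fin ger0_norm ?tail_ge0 //.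
  apply: ler_wpM2l; first exact: cabs_ge0.
  rewrite !indicE ler_nat.
  case: (boolP (w \in superlevel f m.+1%:R)) => //; rewrite inE => h.
  by rewrite mem_set //; apply: le_lt_trans h; rewrite ler1n.
by rewrite integral_cst // mul0e => _ _.
Qed.

(** By the maximal inequality, the averages of the tail beyond m exceed e at some
    time only on a set of measure at most the integral of the tail over e, which
    tends to 0 as m grows. *)
Lemma tail_averages_small : {ae mu, forall w, forall e : R, 0 < e -> exists m : nat,
  forall n, n%:R^-1 * birkhoff_sum tau (tail m.+1%:R) n w <= e}.
Proof.
pose Z (j : nat) := \bigcap_(m : nat) \bigcup_N
  exceedance tau (tail m.+1%:R) j.+1%:R^-1 N.
have j0 j : 0 < j.+1%:R^-1 :> R by rewrite invr_gt0.
have mx j m := maximal_inequality htau (fi (ltr0Sn R m)) (j0 j).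
have mZ j : measurable (Z j).
  by apply: bigcapT_measurable => m; exact: (mx j m).1.
have Z0 j : mu (Z j) = 0%E.
  apply/eqP; rewrite -measure_le0; apply/lee_addgt0Pr => e e0; rewrite add0e.
  have ej0 : 0 < j.+1%:R^-1 * e by rewrite mulr_gt0.
  have [m hm] : exists m : nat,
      (\int[mu]_w (tail m.+1%:R w)%:E < (j.+1%:R^-1 * e)%:E)%E.
    have h : ereal_nbhs (0%E : \bar R) (fun u => (u < (j.+1%:R^-1 * e)%:E)%E).
      by apply: open_ereal_lt'; rewrite lte_fin.
    have [m _ hm] := integral_tail_cvg0 h.
    by exists m; apply: (hm m) => /=.
  apply: (@le_trans _ _ (mu (\bigcup_N exceedance tau (tail m.+1%:R) j.+1%:R^-1 N))).
    by apply: le_measure; rewrite ?inE //; [exact: (mx j m).1|move=> w; apply].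
  apply: le_trans (mx j m).2 _; rewrite lee_fin ler_pdivrMl //.
  have -> : \int[mu]_w `|tail m.+1%:R w| = fine (\int[mu]_w (tail m.+1%:R w)%:E)%E.
    by congr fine; apply: eq_integral => w _; rewrite ger0_norm ?tail_ge0.
  rewrite -lee_fin fineK; first exact: ltW.
  exact: (integrable_fin_num measurableT (fi (ltr0Sn R m))).
have : {ae mu, forall w, forall j, ~ Z j w}.
  by apply: ae_foralln => j; exists (Z j); split=> // w /= /contrapT.
apply: filterS => w nZ e e0.
pose j := Num.truncn e^-1.
have je : j.+1%:R^-1 <= e.
  by rewrite -[leRHS]invrK lef_pV2 ?posrE ?invr_gt0 // ltW // truncnS_gt.
have [m hm] : exists m : nat, forall n,
    birkhoff_sum tau (tail m.+1%:R) n w <= j.+1%:R^-1 * n%:R.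
  apply: contrapT => nex; apply: (nZ j) => m _; apply: contrapT => nU.
  apply: nex; exists m => n; rewrite leNgt; apply/negP => h; apply: nU.
  exists n => //; exists n => //; rewrite leqnn andbT lt0n.
  by apply: contraTneq h => ->; rewrite /birkhoff_sum big_ord0 mulr0 ltxx.
exists m => -[|n]; first by rewrite invr0 mul0r ltW.
by rewrite ler_pdivrMl ?ltr0Sn // mulrC; apply: le_trans (hm _) _; rewrite ler_wpM2r.
Qed.

Definition truncation (eps M : R) (w : T) : R[i] :=
  f w * (\1_(superlevel f eps `\` superlevel f M) w)%:C.

Lemma truncation_le eps M w : 0 <= M -> cabs (truncation eps M w) <= M.
Proof.
move=> M0; rewrite cabsM cabsR indicE normr_nat.
have [h|h] := pselect ((superlevel f eps `\` superlevel f M) w).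
  by rewrite mem_set //= mulr1 leNgt; apply/negP; exact: h.2.
by rewrite memNset // mulr0.
Qed.

Lemma truncation_dist eps M w : 0 <= eps ->
  cabs (f w - truncation eps M w) <= eps + tail M w.
Proof.
move=> e0; rewrite /truncation /tail !indicE.
have [fe|fe] := pselect (superlevel f eps w); last first.
  rewrite memNset /=; last by move=> [].
  rewrite mulr0 subr0; apply: ler_wpDr; first by rewrite mulr_ge0 ?cabs_ge0.
  by rewrite leNgt; exact/negP.
have [fM|fM] := pselect (superlevel f M w).
  rewrite memNset /=; last by move=> [].
  by rewrite (mem_set fM) mulr0 subr0 mulr1 lerDr.
by rewrite mem_set // mulr1 subrr cabs0 memNset // mulr0 addr0.
Qed.

Lemma cmeasurable_truncation eps M : cmeasurable (truncation eps M).
Proof.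
have mA : measurable (superlevel f eps `\` superlevel f M).
  by apply: measurableD; exact: measurable_superlevel.
have mi := @measurable_indic _ T R setT _ mA.
by split; rewrite /truncation; under eq_fun do rewrite mulrC ?Re_scale ?Im_scale;
   apply: measurable_funM => //; [exact: mf.1|exact: mf.2].
Qed.

Lemma integrable_truncation eps M : 0 < eps ->
  mu.-integrable setT (EFin \o (fun w => cabs (truncation eps M w))).
Proof.
move=> e0; apply: (integrable_dominated _ (fi e0)).
  exact/cmeasurable_cabs/cmeasurable_truncation.
move=> w; rewrite ger0_norm ?cabs_ge0 // cabsM cabsR.
apply: ler_wpM2l; first exact: cabs_ge0.
rewrite !indicE normr_nat ler_nat; case: (boolP (w \in _ `\` _)) => //.
by rewrite inE => -[h _]; rewrite mem_set.
Qed.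

End truncation.

(** * Convergence of the weighted averages *)

Theorem theorem6p2 (R : realType) (d : measure_display) (T : measurableType d)
    (mu : {measure set T -> \bar R}) (hmu : sigma_finite [set: T] mu)
    (tau : T -> T) (htau : measure_preserving mu tau)
    (E : set (measurableTypeR R -> R[i]))
    (N : (measurableTypeR R -> R[i]) -> R) (hE : fully_symmetric E N)
    (h1 : ~ generated_space mu E (fun=> 1))
    (f : T -> R[i]) (hf : generated_space mu E f) :
  exists Omegaf : set T,
    [/\ measurable Omegaf, mu (~` Omegaf) = 0%E &
      forall w : T, Omegaf w ->
      forall beta : nat -> R[i], bounded_Besicovitch beta ->
        cvgn (weighted_average tau beta f w : nat -> R[i]^o)].
Proof.
have mf : cmeasurable f := proj1 (proj1 hf).
have fi (c : R) (c0 : 0 < c) := integrable_above hE h1 hf c0.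
(* The skew product is formed on mu as a sigma-finite measure. *)
pose sfin := isSFinite.Build _ _ _ _ (sfinite_measure_sigma_finite hmu).
pose sigfin := isSigmaFinite.Build _ _ _ _ hmu.
pose sigma_mu : {sigma_finite_measure set T -> \bar R} :=
  HB.pack_for {sigma_finite_measure set T -> \bar R} (Measure.sort mu) sfin sigfin.
have eps0 j : 0 < j.+1%:R^-1 :> R by rewrite invr_gt0.
pose g (j m : nat) := truncation f j.+1%:R^-1 m.+1%:R.
have ww j m : {ae mu, forall w, forall z, `|z| = 1 ->
    cvgn (exponential_average (orbit_values tau (g j m) w) z : nat -> R[i]^o)}.
  apply: (@wiener_wintner_bounded R d T sigma_mu tau htau (g j m) m.+1%:R).
  - exact: cmeasurable_truncation.
  - by move=> w; exact: truncation_le.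
  - exact: integrable_truncation.
have aeww : {ae mu, forall w, forall j m z, `|z| = 1 ->
    cvgn (exponential_average (orbit_values tau (g j m) w) z : nat -> R[i]^o)}.
  pose F (k : nat) w := let: (j, m) := odflt (0%N, 0%N) (unpickle k) in
    forall z, `|z| = 1 ->
    cvgn (exponential_average (orbit_values tau (g j m) w) z : nat -> R[i]^o).
  have aeF k : {ae mu, forall w, F k w}.
    by rewrite /F; case: (odflt _ _) => j m; exact: ww.
  apply: filterS (ae_foralln aeF) => w Fw j m.
  by have := Fw (pickle (j, m)); rewrite /F pickleK.
have [Z [mZ Z0 sZ]] := filterI aeww (tail_averages_small htau fi).
exists (~` Z); split; [exact: measurableC|by rewrite setCK|].
move=> w nZ beta hbeta.
have [cw small] : (forall j m z, `|z| = 1 ->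
    cvgn (exponential_average (orbit_values tau (g j m) w) z : nat -> R[i]^o)) /\
    forall e : R, 0 < e -> exists m : nat,
      forall n, n%:R^-1 * birkhoff_sum tau (tail f m.+1%:R) n w <= e.
  by apply: contrapT => h; apply: nZ; apply: sZ.
have [[C betaC] _] := hbeta.
apply: (bounded_weight_mean_cvg (a := orbit_values tau f w) betaC) => e e0.
pose j := Num.truncn (2 / e).
have je : j.+1%:R^-1 <= e / 2.
  rewrite -[leRHS]invrK lef_pV2 ?posrE ?invr_gt0 ?divr_gt0 // invf_div.
  exact/ltW/truncnS_gt.
have [m hm] := small _ (divr_gt0 e0 (ltr0n _ 2)).
exists (orbit_values tau (g j m) w).
  apply: (besicovitch_mean_cvg (M := m.+1%:R)) => //.
  - by move=> k; exact: truncation_le.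
  - by move=> z z1; exact: cw.
apply: nearW => n.
apply: (@le_trans _ _ (n%:R^-1 * \sum_(k < n)
    (j.+1%:R^-1 + tail f m.+1%:R (iter k tau w)))).
  apply: ler_wpM2l; first by rewrite invr_ge0.
  by apply: ler_sum => k _; apply: truncation_dist; rewrite ltW.
rewrite big_split /= mulrDr [leRHS]splitr; apply: lerD; last exact: hm.
by apply: (mean_le_cst (x := fun=> _)); rewrite ?divr_ge0 ?(ltW e0).
Qed.
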